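(* Let $\mathcal C$ be a proper open convex cone and work in the coordinates described in the context. For every $\mathcal C$-convex domain $K$ with support function $s:\Omega^*\to\mathbb R$, one has the equality of measures on $\Omega^*$ $$\mathrm A(K)=(-\omega_{\mathcal C})\,\mathrm{MA}(s).$$
   Context: Setting: $d\ge2$; $\mathbb V^{d+1}$ is an oriented $(d+1)$-dimensional real vector space with a linear volume form; $\mathbb A^{d+1}$ is the real affine space with translation space $\mathbb V^{d+1}$, with the induced volume measure $\mathrm{vol}$. A convex cone is proper if it is non-empty and its closure contains no entire line. $\mathcal C^*=\mathrm{int}\{\varphi\in(\mathbb V^{d+1})^*:\varphi(v)\le0\ \forall v\in\mathcal C\}$; a point $[\varphi]\in\mathbb P(\mathcal C^* )$ is identified with $\ker\varphi$, regarded as a direction of affine hyperplanes. A convex domain is a non-empty open convex set; a supporting hyperplane of it is an affine hyperplane $H$ with $H\cap K=\emptyset$, $H\cap\partial K\ne\emptyset$. A $\mathcal C$-convex domain is a convex domain $K$ with $K+\mathcal C=K$ whose set of directions of supporting hyperplanes contains $\mathbb P(\mathcal C^* )$ and is contained in $\overline{\mathbb P(\mathcal C^* )}$. Coordinates and affine sphere: choose an origin and positively oriented unit-volume basis so that $\mathbb A^{d+1}\simeq\mathbb V^{d+1}\simeq\mathbb R^{d+1}$ and $\mathcal C=\{t(x,1):x\in\Omega,t>0\}$ with $\Omega\subset\mathbb R^d$ bounded open convex containing $0$; then $\mathcal C^*=\{t(y,-1):y\in\Omega^*,t>0\}$ with $\Omega^*=\{y:x\cdot y<1\ \forall x\in\overline\Omega\}$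 and $\mathbb P(\mathcal C^* )\simeq\Omega^*$. Let $\omega_{\mathcal C}:\Omega^*\to(-\infty,0)$ be the unique smooth convex function with $\det\mathrm{Hess}\,\omega=(-\omega)^{-d-2}$ in $\Omega^*$, $\omega|_{\partial\Omega^*}=0$. The map $N_{\Sigma_{\mathcal C}}(y)=(\nabla\omega_{\mathcal C}(y),\nabla\omega_{\mathcal C}(y)\cdot y-\omega_{\mathcal C}(y))$ parametrises the Cheng--Yau affine sphere $\Sigma_{\mathcal C}$. The support function of $K$ is the convex function $s(y)=\sup_{X\in K}X\cdot(y,-1)$, $y\in\Omega^*$. Area measure: for Borel $b\subseteq\mathbb P(\mathcal C^* )\simeq\Omega^*$, $\mathcal N_\varepsilon(K)(b)$ is the set of points $P+tN_{\Sigma_{\mathcal C}}[\varphi]$ with $[\varphi]\in b$, $t\in(0,\varepsilon)$, and $P\in\partial K$ a point at which $K$ has a supporting hyperplane of direction $[\varphi]$; $V_\varepsilon(K)(b)=\mathrm{vol}(\mathcal N_\varepsilon(K)(b))$. There are unique Radon measures $S_i(K)$ on $\mathbb P(\mathcal C^* )$ with $V_\varepsilon(K)=\frac1{d+1}\sum_{i=0}^d\varepsilon^{d+1-i}\binom{d+1}iS_i(K)$ for all $\varepsilon>0$; the area measure is $\mathrm A(K)=S_d(K)$. Monge--Ampère measure: for a convex function $s$ on an open convex $U\subset\mathbb R^d$ and Borel $b\subseteq U$, $\mathrm{MA}(s)(b)=\mathcal L\bigl(\bigcup_{x\in b}\partial s(x)\bigr)$, where $\partial s(x)$ is the subdifferential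 and $\mathcal L$ Lebesgue measure. *)

(* Defs.v *)
From HB Require Import structures.
From mathcomp Require Import all_boot all_order all_algebra.
From mathcomp Require Import all_classical all_reals all_analysis.

Set Implicit Arguments.
Unset Strict Implicit.
Unset Printing Implicit Defensive.

Import Order.TTheory GRing.Theory Num.Theory.
Import numFieldNormedType.Exports.

Local Open Scope classical_set_scope.
Local Open Scope ring_scope.

(* Once coordinates are chosen, the affine space, its
   translation space and the dual of the latter are all 'rV[R]_(d + 1), a
   covector phi acting by X |-> dot phi X. *)

Section Euclidean.
Variable R : realType.

Definition dot n (x y : 'rV[R]_n) : R := (x *m y^T) 0 0.

(* the point (x, t) of R^d x R *)
Definition pt d (x : 'rV[R]_d) (t : R) : 'rV[R]_(d + 1) :=
  row_mx x (const_mx t).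

Definition boundary n (A : set 'rV[R]_n) : set 'rV[R]_n :=
  closure A `\` interior A.

(* R^n with its Borel sigma-algebra; the carrier is convertible to 'rV[R]_n *)
Definition borelType n := g_sigma_algebraType (@open 'rV[R]_n).

Definition box n (a b : 'rV[R]_n) : set 'rV[R]_n :=
  [set x | forall i, a 0 i < x 0 i <= b 0 i].

Definition box_vol n (a b : 'rV[R]_n) : R :=
  \prod_(i < n) Num.max 0 (b 0 i - a 0 i).

(* Lebesgue outer measure, defined on all subsets: the sets to which it is
   applied below are Lebesgue measurable, but need not be Borel. *)
Definition lebesgue n (A : set 'rV[R]_n) : \bar R :=
  ereal_inf [set v | exists a b : nat -> 'rV[R]_n,
    A `<=` \bigcup_k box (a k) (b k) /\
    v = (\sum_(0 <= k <oo) (box_vol (a k) (b k))%:E)%E].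

End Euclidean.

Section Differentials.
Variables (R : realType) (d : nat).
Implicit Types (f : 'rV[R]_d -> R) (U : set 'rV[R]_d).

Definition partial (i : 'I_d) f : 'rV[R]_d -> R :=
  fun y => 'D_(delta_mx 0 i) f y.

Definition gradient f (y : 'rV[R]_d) : 'rV[R]_d := \row_i partial i f y.

Definition hessian f (y : 'rV[R]_d) : 'M[R]_d :=
  \matrix_(i, j) partial i (partial j f) y.

(* C^infty on the open set U: iterated partial derivatives of all orders are
   differentiable at every point of U *)
Definition smooth_on U f :=
  forall (s : seq 'I_d) (y : 'rV[R]_d), U y ->
    differentiable (foldr partial f s) y.

Definition subdifferential U f (x : 'rV[R]_d) : set 'rV[R]_d :=
  [set p | forall z, U z -> f x + dot p (z - x) <= f z].

(* Monge-Ampere measure of f on U, as a set function on R^d carried by U *)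
Definition monge_ampere U f (b : set (borelType R d)) : \bar R :=
  lebesgue (\bigcup_(x in (b : set 'rV[R]_d) `&` U) subdifferential U f x).

End Differentials.

Section Cones.
Variable R : realType.

Definition convex_cone n (C : set 'rV[R]_n) :=
  convex_set C /\ forall (t : R) v, 0 < t -> C v -> C (t *: v).

Definition contains_line n (A : set 'rV[R]_n) :=
  exists p v : 'rV[R]_n, v != 0 /\ forall t : R, A (p + t *: v).

Definition proper_convex_cone n (C : set 'rV[R]_n) :=
  [/\ convex_cone C, C !=set0 & ~ contains_line (closure C)].

Definition dual_cone n (C : set 'rV[R]_n) : set 'rV[R]_n :=
  interior [set phi | forall v, C v -> dot phi v <= 0].

(* A subset of the projective space P is represented by its preimage in the
   set of nonzero vectors. Since the projection to P is an open map, the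
   preimage of a closure in P is the closure of the preimage relative to the
   nonzero vectors. *)
Definition proj_points n (A : set 'rV[R]_n) : set 'rV[R]_n :=
  [set phi | phi != 0 /\ exists2 l : R, l != 0 & A (l *: phi)].

Definition proj_closure n (A : set 'rV[R]_n) : set 'rV[R]_n :=
  [set phi | phi != 0 /\ closure (proj_points A) phi].

Definition hyperplane n (phi : 'rV[R]_n) (c : R) : set 'rV[R]_n :=
  [set X | dot phi X = c].

Definition supporting_hyperplane n (K : set 'rV[R]_n) (phi : 'rV[R]_n)
    (c : R) :=
  [/\ phi != 0, hyperplane phi c `&` K = set0 &
      hyperplane phi c `&` boundary K !=set0].

Definition supporting_directions n (K : set 'rV[R]_n) : set 'rV[R]_n :=
  [set phi | exists c, supporting_hyperplane K phi c].

Definition convex_domain n (K : set 'rV[R]_n) :=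
  [/\ K !=set0, open K & convex_set K].

Definition C_convex_domain n (C K : set 'rV[R]_n) :=
  [/\ convex_domain K,
      [set X + v | X in K & v in C] = K,
      proj_points (dual_cone C) `<=` supporting_directions K &
      supporting_directions K `<=` proj_closure (dual_cone C)].

End Cones.

Section AreaMeasure.
Variables (R : realType) (d : nat).
Implicit Types (Omega Os : set 'rV[R]_d) (omega : 'rV[R]_d -> R).
Implicit Types (K : set 'rV[R]_(d + 1)).

Definition cone_over Omega : set 'rV[R]_(d + 1) :=
  [set X | exists t x, [/\ 0 < t, Omega x & X = t *: pt x 1]].

(* Omega^*; y stands for the projective point of the covector (y, -1) *)
Definition polar Omega : set 'rV[R]_d :=
  [set y | forall x, closure Omega x -> dot x y < 1].

(* omega is the solution of the Cheng-Yau problem on Os = Omega^*; only its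
   restriction to Os matters, and its boundary value 0 is taken as a limit *)
Definition cheng_yau_solution Os omega :=
  [/\ smooth_on Os omega,
      @convex_function R 'rV[R]_d Os omega,
      forall y, Os y -> omega y < 0,
      forall y, Os y -> \det (hessian omega y) = (- omega y) ^- d.+2 &
      forall z, boundary Os z -> omega y @[y --> within Os (nbhs z)] --> 0].

(* N_Sigma, the parametrisation of the affine sphere *)
Definition normal_map omega (y : 'rV[R]_d) : 'rV[R]_(d + 1) :=
  pt (gradient omega y) (dot (gradient omega y) y - omega y).

Definition support_function K (y : 'rV[R]_d) : R :=
  sup [set dot X (pt y (- 1)) | X in K].

Definition normal_nbhd omega K (eps : R) (b : set 'rV[R]_d) :
    set 'rV[R]_(d + 1) :=
  [set Z | exists y P t,
    [/\ b y, 0 < t < eps, boundary K P,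
        exists2 c, supporting_hyperplane K (pt y (- 1)) c &
                   hyperplane (pt y (- 1)) c P &
        Z = P + t *: normal_map omega y]].

(* Measures on Os are given by Borel measures on R^d of which only the values
   on subsets of Os are used. On an open subset of R^d a Borel measure is Radon
   when it is finite on compact sets. *)
Definition radon_on Os (mu : {measure set (borelType R d) -> \bar R}) :=
  forall k : set 'rV[R]_d, compact k -> k `<=` Os -> (mu k < +oo)%E.

Definition steiner_formula Os omega K
    (S : 'I_d.+1 -> {measure set (borelType R d) -> \bar R}) :=
  forall (eps : R) (b : set (borelType R d)),
    0 < eps -> measurable b -> (b : set 'rV[R]_d) `<=` Os ->
    lebesgue (normal_nbhd omega K eps b) =
    ((d.+1%:R^-1)%:E *
     \sum_(i < d.+1) (eps ^+ (d.+1 - i) * 'C(d.+1, i)%:R)%:E * S i b)%E.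

(* A is the area measure S_d(K) *)
Definition is_area_measure Os omega K
    (A : {measure set (borelType R d) -> \bar R}) :=
  exists S : 'I_d.+1 -> {measure set (borelType R d) -> \bar R},
    [/\ forall i, radon_on Os (S i),
        steiner_formula Os omega K S & S ord_max = A].

End AreaMeasure.

(* Main.v *)
(** For [p] in the subdifferential of the support function [s] at [y], the
    boundary point of [K] with normal [y] over [p] is [(p, p.y - s y)], and moving
    it by [t N(y)] gives the point of the graph of the conjugate [(s + t omega)^*]
    over [q = p + t grad omega y].
    Over a fixed [q] the height of this point grows with [t] at speed [- omega y].
    Hence the normal neighbourhood of width [eps] of a compact [k] lies in a strip
    of thickness [eps sup_k (- omega)] above the graph of [s^*], over a small
    neighbourhood of the image of [k] under the subdifferential; and conversely
    that of an open [U] containing [k] has fibres of length at least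
    [eps inf_U (- omega)] over almost all of that image, because the set of [q]
    with several maximisers of [q.y - s y] is Lebesgue null.
    Dividing by [eps], the Steiner formula yields
    [inf (- omega) MA(s) <= A(K) <= sup (- omega) MA(s)], first on open and compact
    sets, then on Borel sets by regularity of [A(K)]. These bounds
    determine [A(K)] as an integral against simple functions, and no additivity
    of [MA(s)] is needed. *)
Require Import Defs.
From HB Require Import structures.
From mathcomp Require Import all_boot all_order all_algebra.
From mathcomp Require Import all_classical all_reals all_analysis.
From mathcomp Require Import measurable_realfun zify ring lra.

Set Implicit Arguments.
Unset Strict Implicit.
Unset Printing Implicit Defensive.

Import Order.TTheory GRing.Theory Num.Theory.
Import numFieldNormedType.Exports.

Local Open Scope classical_set_scope.
Local Open Scope ring_scope.

(** * Lebesgue outer measure of boxes *)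

Section LebesgueOuter.
Variable R : realType.

(** Two obstacles shape the argument. First, [lebesgue] is an outer measure, and neither the normal
    neighbourhoods nor the images of Borel sets under the subdifferential are shown to be
    measurable. Volumes are therefore compared without Fubini or a change of variables: from above
    by stacking disjoint translates of a strip, from below by adding up the lengths of the boxes of
    a cover over each base point. Continuity of the measure is applied only to compact sets built
    from images of compact sets. Second, in the lower bound the maximiser of [q.z - s z - t omega z]
    moves with [t] and may leave [U], at a rate depending on [q], whereas dividing by [eps] requires
    a set of [q] independent of [eps]. Hence [gap_set]: there every point outside [U] misses the
    maximum of [q.z - s z] by at least [g], and as [- omega <= W] the maximiser stays in [U] when
    [eps * W < g]. The limit in [eps] is taken with [g] fixed; only then does [g] tend to 0, and the
    gap sets exhaust the image up to a null set. *)

Lemma box_vol_ge0 n (a b : 'rV[R]_n) : 0 <= box_vol a b.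
Proof. by apply: prodr_ge0 => i _; rewrite le_max lexx. Qed.

Lemma box_vol_series_ge0 n (a b : nat -> 'rV[R]_n) :
  (0 <= \sum_(0 <= k <oo) (box_vol (a k) (b k))%:E)%E.
Proof. by apply: nneseries_ge0 => k _ _; rewrite lee_fin box_vol_ge0. Qed.

Lemma lebesgue_ge0 n (A : set 'rV[R]_n) : (0 <= lebesgue A)%E.
Proof.
by apply: le_ereal_inf_tmp => _ [a [b [_ ->]]]; exact: box_vol_series_ge0.
Qed.

Lemma le_lebesgue n : {homo @lebesgue R n : A B / A `<=` B >-> (A <= B)%E}.
Proof.
move=> A B AB; apply: ereal_inf_le_tmp => _ [a [b [Bab ->]]].
by exists a, b; split => //; exact: subset_trans Bab.
Qed.

Lemma lebesgue_le_cover n (A : set 'rV[R]_n) (a b : nat -> 'rV[R]_n) :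
  A `<=` \bigcup_k box (a k) (b k) ->
  (lebesgue A <= \sum_(0 <= k <oo) (box_vol (a k) (b k))%:E)%E.
Proof. by move=> Aab; apply: ereal_inf_lbound; exists a, b. Qed.

(** Degenerate boxes pad a finite cover to a sequence. In dimension 0 every box has volume 1, an
    empty product, and [lebesgue] is infinite even on the empty set; hence the dimensions [n.+1]
    from here on. *)
Lemma box_vol0 n (a : 'rV[R]_n.+1) : box_vol a a = 0.
Proof.
by rewrite /box_vol (bigD1 ord0)//= subrr maxxx mul0r.
Qed.

Lemma lebesgue_box n (a b : 'rV[R]_n.+1) :
  (lebesgue (box a b) <= (box_vol a b)%:E)%E.
Proof.
pose b' k := if k is 0%N then b else a.
apply: (@le_trans _ _ (\sum_(0 <= k <oo) (box_vol a (b' k))%:E)%E).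
  by apply: (@lebesgue_le_cover _ _ (fun=> a)) => x abx; exists 0%N.
rewrite nneseries_recl//=; last by move=> k _; rewrite lee_fin box_vol_ge0.
rewrite eseries_cond/= eseries0 ?adde0// => -[|k]//= _ _.
by rewrite box_vol0.
Qed.

Lemma lebesgue_set0 n : lebesgue (set0 : set 'rV[R]_n.+1) = 0.
Proof.
apply/eqP; rewrite eq_le lebesgue_ge0 andbT.
apply: le_trans (@le_lebesgue _ _ (box 0 0) _) _; first by [].
by apply: le_trans (lebesgue_box _ _) _; rewrite box_vol0.
Qed.

Lemma lebesgue_adherent n (A : set 'rV[R]_n) (e : R) : 0 < e ->
  (lebesgue A < +oo)%E -> exists a b : nat -> 'rV[R]_n,
    A `<=` \bigcup_k box (a k) (b k) /\
    (\sum_(0 <= k <oo) (box_vol (a k) (b k))%:E <= lebesgue A + e%:E)%E.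
Proof.
move=> e0 Aoo.
have /(lb_ereal_inf_adherent e0) [_ [a [b [Aab ->]]] /ltW ?] :
  lebesgue A \is a fin_num by rewrite ge0_fin_numE ?lebesgue_ge0.
by exists a, b.
Qed.

Lemma lebesgue_sigma_subadditive n :
  sigma_subadditive (@lebesgue R n).
Proof.
move=> A; have [[i ioo]|] := pselect (exists i, lebesgue (A i) = +oo%E).
  rewrite (eseries_pinfty _ _ ioo) ?leey// => k _.
  by rewrite -ltNye (lt_le_trans _ (lebesgue_ge0 _)).
rewrite -forallNE => Aoo.
suff add2e (e : {posnum R}) :
    (lebesgue (\bigcup_n A n) <= \sum_(i <oo) lebesgue (A i) + e%:num%:E)%E.
  by apply/lee_addgt0Pr => _/posnumP[].
rewrite (le_trans _ (epsilon_trick _ _ _))//; last first.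
  by move=> k; exact: lebesgue_ge0.
pose P k (B : nat -> 'rV[R]_n * 'rV[R]_n) :=
  A k `<=` \bigcup_j box (B j).1 (B j).2 /\
  (\sum_(j <oo) (box_vol (B j).1 (B j).2)%:E <=
    lebesgue (A k) + (e%:num / (2 ^ k.+1)%:R)%:E)%E.
have [G PG] : {G : nat -> nat -> 'rV[R]_n * 'rV[R]_n & forall k, P k (G k)}.
  apply: (@choice _ _ P) => k.
  have [a [b [Aab abe]]] := @lebesgue_adherent n (A k) (e%:num / (2 ^ k.+1)%:R)
    ltac:(by []) ltac:(by rewrite ltey; exact/eqP).
  by exists (fun j => (a j, b j)).
pose v (ij : nat * nat) : \bar R :=
  (box_vol (G ij.1 ij.2).1 (G ij.1 ij.2).2)%:E.
have v0 x : (0 <= v x)%E by rewrite lee_fin box_vol_ge0.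
apply: (@le_trans _ _ (\esum_(i in [set: nat * nat]) v i)).
  have /card_esym/ppcard_eqP[f] := card_nat2.
  rewrite (reindex_esum [set: nat] [set: nat * nat] f)//.
  rewrite -nneseries_esumT//.
  apply: (@lebesgue_le_cover _ _ (fun k => (G (f k).1 (f k).2).1)
     (fun k => (G (f k).1 (f k).2).2)).
  move=> t [i _ /(PG i).1 [j _ tij]].
  by exists (f^-1%FUN (i, j)) => //=; rewrite invK ?inE.
rewrite -[setT]setXTT -(@esum_esum _ _ _ setT (fun=> setT) (fun i j => v (i, j)))//.
rewrite -nneseries_esumT; last by move=> k; apply: esum_ge0 => j _; exact: v0.
apply: lee_nneseries => [k _ _|k _]; first by apply: esum_ge0 => j _; exact: v0.
by rewrite -nneseries_esumT//; exact: (PG k).2.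
Qed.

HB.instance Definition _ n := isOuterMeasure.Build R 'rV[R]_n.+1
  (@lebesgue R n.+1) (@lebesgue_set0 n) (@lebesgue_ge0 n.+1) (@le_lebesgue n.+1)
  (@lebesgue_sigma_subadditive n.+1).

End LebesgueOuter.

(** * Borel sets are Caratheodory measurable *)

Section LebesgueBorel.
Variable R : realType.

Definition set_coord n (i : 'I_n) (c : R) (x : 'rV[R]_n) : 'rV[R]_n :=
  \row_j if j == i then c else x 0 j.

(** Boxes exclude their lower faces and include their upper ones, so a closed half space and its
    open complement cut a box exactly into two boxes of the same kind. *)
Lemma box_le_halfspace n (a b : 'rV[R]_n) i c :
  box a b `&` [set x | x 0 i <= c] = box a (set_coord i (Num.min (b 0 i) c) b).
Proof.
apply/seteqP; split => [x [abx xc] j|x abx].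
  rewrite mxE; case: eqVneq => [->|_]; last exact: abx.
  by have /andP[-> xb] := abx i; rewrite le_min xb.
split=> [j|/=].
  have := abx j; rewrite mxE; case: eqVneq => // ->.
  by rewrite le_min => /and3P[-> ->].
by have := abx i; rewrite mxE eqxx le_min => /and3P[].
Qed.

Lemma box_gt_halfspace n (a b : 'rV[R]_n) i c :
  box a b `&` ~` [set x | x 0 i <= c] = box (set_coord i (Num.max (a 0 i) c) a) b.
Proof.
apply/seteqP; split => [x [abx xc] j|x abx].
  rewrite mxE; case: eqVneq => [->|_]; last exact: abx.
  have /andP[xa ->] := abx i; rewrite gt_max xa andbT/=.
  by rewrite ltNge; exact/negP.
split=> [j|/=].
  have := abx j; rewrite mxE; case: eqVneq => // ->.
  by rewrite gt_max => /andP[/andP[-> _] ->].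
have := abx i; rewrite mxE eqxx gt_max => /andP[/andP[_ cx] _].
by apply/negP; rewrite -ltNge.
Qed.

Lemma box_vol_split n (a b : 'rV[R]_n) i c :
  box_vol a (set_coord i (Num.min (b 0 i) c) b) +
  box_vol (set_coord i (Num.max (a 0 i) c) a) b = box_vol a b.
Proof.
rewrite /box_vol (bigD1 i)//= [X in _ + X](bigD1 i)//= [RHS](bigD1 i)//= !mxE eqxx.
under eq_bigr => j ji do rewrite mxE (negbTE ji).
under [X in _ + _ * X = _]eq_bigr => j ji do rewrite mxE (negbTE ji).
rewrite -mulrDl; congr (_ * _).
case: (leP (b 0 i) c) => bc; case: (leP (a 0 i) c) => ac.
- by rewrite (max_l (_ : b 0 i - c <= 0)) ?subr_le0// addr0.
- by rewrite (max_l (_ : b 0 i - a 0 i <= 0)) ?addr0// subr_le0; lra.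
- by rewrite !max_r ?subr_ge0//; lra.
- by rewrite (max_l (_ : c - a 0 i <= 0)) ?add0r// subr_le0; lra.
Qed.

(** Each box of an almost optimal cover of [X] is cut in two without loss of volume, and the pieces
    cover the two parts of [X]. *)
Lemma halfspace_caratheodory n (i : 'I_n.+1) (c : R) :
  caratheodory_measurable (@lebesgue R n.+1) [set x | x 0 i <= c].
Proof.
apply: le_caratheodory_measurable => X /=.
have [Xoo|] := ltP (lebesgue X) +oo%E; last by rewrite leye_eq => /eqP ->; rewrite leey.
apply/lee_addgt0Pr => e e0.
have [a [b [Xab abe]]] := lebesgue_adherent e0 Xoo.
apply: le_trans abe.
under eq_eseriesr => k _ do rewrite -(box_vol_split (a k) (b k) i c) EFinD.
rewrite nneseriesD//; last 2 first.
  by move=> k _ _; rewrite lee_fin box_vol_ge0.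
  by move=> k _ _; rewrite lee_fin box_vol_ge0.
apply: leeD.
  apply: (lebesgue_le_cover (a := a)) => x [/Xab[k _ abx] xc].
  by exists k => //; rewrite -box_le_halfspace.
apply: (lebesgue_le_cover (b := b)) => x [/Xab[k _ abx] xc].
by exists k => //; rewrite -box_gt_halfspace.
Qed.

Lemma open_bigcup_box n (U : set 'rV[R]_n) : open U ->
  U = \bigcup_(ab in [set ab : 'rV[rat]_n * 'rV[rat]_n |
         box (map_mx ratr ab.1) (map_mx ratr ab.2) `<=` U])
       box (map_mx ratr ab.1) (map_mx ratr ab.2).
Proof.
move=> oU; apply/seteqP; split => [x Ux|x [ab abU]]; last exact: abU.
have /nbhs_ballP[e /= e0 xeU] := open_nbhs_nbhs (conj oU Ux).
have /choice[q qP] : forall i : 'I_n, exists q, ratr q \in `]x 0 i - e, x 0 i[.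
  by move=> i; apply: rat_in_itvoo; lra.
have /choice[r rP] : forall i : 'I_n, exists r, ratr r \in `]x 0 i, x 0 i + e[.
  by move=> i; apply: rat_in_itvoo; lra.
exists (\row_i q i, \row_i r i) => /=.
  move=> z abz; apply: xeU; split=> // i j; rewrite (ord1 i) /ball/=.
  have := abz j; rewrite !mxE; move: (qP j) (rP j); rewrite !in_itv/=.
  move=> /andP[? ?] /andP[? ?] /andP[? ?].
  by rewrite ltr_distlC; apply/andP; split; lra.
move=> j; rewrite !mxE; move: (qP j) (rP j); rewrite !in_itv/=.
by move=> /andP[? ?] /andP[? ?]; apply/andP; split; lra.
Qed.

Lemma box_bigcap n (a b : 'rV[R]_n) : box a b = \bigcap_(i in [set: 'I_n])
   ([set x : 'rV[R]_n | x 0 i <= b 0 i] `&` ~` [set x | x 0 i <= a 0 i]).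
Proof.
apply/seteqP; split => [x abx i _|x abx i].
  by have /andP[ax ?] := abx i; split=> //; apply/negP; rewrite -ltNge.
by have [//|xb /negP] := abx i; rewrite /= -ltNge => ->.
Qed.

Lemma box_caratheodory n (a b : 'rV[R]_n.+1) :
  caratheodory_measurable (@lebesgue R n.+1) (box a b).
Proof.
suff : measurable (box a b : set (caratheodory_type (@lebesgue R n.+1))) by [].
rewrite box_bigcap; apply: fin_bigcap_measurable => // i _.
apply: measurableI; first exact: halfspace_caratheodory.
exact/measurableC/halfspace_caratheodory.
Qed.

Lemma borel_caratheodory n (A : set (borelType R n.+1)) : measurable A ->
  caratheodory_measurable (@lebesgue R n.+1) A.
Proof.
move: A; apply: smallest_sub.
  split; first exact: caratheodory_measurable_set0.
    move=> A mA; rewrite setTD; exact: caratheodory_measurable_setC.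
  exact: caratheodory_measurable_bigcup.
move=> U /open_bigcup_box ->.
pose T := caratheodory_type (@lebesgue R n.+1).
suff : measurable (\bigcup_(ab in [set ab : 'rV[rat]_n.+1 * 'rV[rat]_n.+1 |
         box (map_mx ratr ab.1) (map_mx ratr ab.2) `<=` U])
       box (map_mx ratr ab.1) (map_mx ratr ab.2) : set T) by [].
rewrite bigcup_mkcond; apply: countable_bigcupT_measurable => // ab.
by case: ifP => _; [exact: box_caratheodory|exact: measurable0].
Qed.

(** The same set function under a second name, typed on the Borel sigma-algebra, which carries the
    structure of a measure while [lebesgue] carries that of an outer measure. *)
Definition borel_lebesgue n (A : set (borelType R n.+1)) : \bar R :=
  @lebesgue R n.+1 A.

Lemma borel_lebesgue_sigma_additive n : semi_sigma_additive (@borel_lebesgue n).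
Proof.
move=> A mA tA mUA.
apply: (caratheodory_measure_sigma_additive (mu := @lebesgue R n.+1)) => //.
  by move=> k; exact: borel_caratheodory.
exact: borel_caratheodory.
Qed.

HB.instance Definition _ n := isMeasure.Build _ _ _ (@borel_lebesgue n)
  (@lebesgue_set0 R n) (@lebesgue_ge0 R n.+1) (@borel_lebesgue_sigma_additive n).

Lemma open_borel n (U : set 'rV[R]_n) :
  open U -> measurable (U : set (borelType R n)).
Proof. exact: sub_sigma_algebra. Qed.

Lemma closed_borel n (F : set 'rV[R]_n) :
  closed F -> measurable (F : set (borelType R n)).
Proof.
move=> cF; rewrite -(setCK F); apply: measurableC.
by apply: open_borel; exact: closed_openC.
Qed.

Lemma box_borel n (a b : 'rV[R]_n) : measurable (box a b : set (borelType R n)).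
Proof.
rewrite box_bigcap; apply: fin_bigcap_measurable => // i _.
have mH (r : R) : measurable ([set x : 'rV[R]_n | x 0 i <= r] : set (borelType R n)).
  apply: closed_borel.
  rewrite (_ : mkset _ = (fun x : 'rV[R]_n => x 0 i) @^-1` [set x | x <= r])//.
  apply: preimage_closed; last exact: closed_le.
  by move=> x _; exact: coord_continuous.
by apply: measurableI; [exact: mH|apply: measurableC; exact: mH].
Qed.

Lemma compact_closed_rV n (F : set 'rV[R]_n) : compact F -> closed F.
Proof. by apply: compact_closed; exact: norm_hausdorff. Qed.

Lemma compact_borel n (F : set 'rV[R]_n) :
  compact F -> measurable (F : set (borelType R n)).
Proof. by move=> cF; apply: closed_borel; exact: compact_closed_rV. Qed.

End LebesgueBorel.

(** * Translates, strips and fibres *)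

Section Strips.
Variable R : realType.

Lemma coord_le_norm n (x : 'rV[R]_n) i : `|x 0 i| <= `|x|.
Proof.
rewrite [leRHS]/Num.norm /= mx_normrE.
by apply: (le_bigmax _ (fun ij : 'I_1 * 'I_n => `|x ij.1 ij.2|) (0, i)).
Qed.

Lemma norm_le_coord n (x : 'rV[R]_n) c : 0 <= c ->
  (forall i, `|x 0 i| <= c) -> `|x| <= c.
Proof.
move=> c0 xc; rewrite [leLHS]/Num.norm /= mx_normrE.
by apply: bigmax_le => // -[i j] _ /=; rewrite (ord1 i).
Qed.

Lemma lipschitz_continuous_fun (V : normedModType R) (g : V -> R) L :
  (forall x y, `|g x - g y| <= L * `|x - y|) -> continuous g.
Proof.
move=> gL x A /nbhs_ballP[e /= e0 eA].
apply/nbhs_ballP; exists (e / (`|L| + 1)) => /=; first by rewrite divr_gt0// ltr_wpDl.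
move=> y; rewrite -ball_normE /= ltr_pdivlMr ?ltr_wpDl// => xye.
apply: eA; rewrite -ball_normE /=.
apply: le_lt_trans (gL _ _) _; apply: le_lt_trans xye.
by rewrite mulrC ler_wpM2l// (le_trans (ler_norm _))// lerDl.
Qed.

Lemma continuous_borel n m (f : 'rV[R]_n -> 'rV[R]_m) (A : set (borelType R m)) :
  continuous f -> measurable A -> measurable (f @^-1` A : set (borelType R n)).
Proof.
move=> cf; move: A; apply: smallest_sub.
  split => [|A|F].
  - by rewrite /= preimage_set0; exact: measurable0.
  - by rewrite /= setTD -preimage_setC; exact: measurableC.
  - by move=> mF /=; rewrite preimage_bigcup; exact: bigcupT_measurable.
by move=> U oU; apply: open_borel; exact: open_comp.
Qed.

Definition translate n (v : 'rV[R]_n) (A : set 'rV[R]_n) : set 'rV[R]_n :=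
  [set x + v | x in A].

Lemma lebesgue_translate n (v : 'rV[R]_n) (A : set 'rV[R]_n) :
  lebesgue (translate v A) = lebesgue A.
Proof.
have le B (w : 'rV[R]_n) : (lebesgue (translate w B) <= lebesgue B)%E.
  apply: le_ereal_inf_tmp => _ [a [b [Bab ->]]].
  apply: (@le_trans _ _ (\sum_(0 <= k <oo) (box_vol (a k + w) (b k + w))%:E)%E).
    apply: (lebesgue_le_cover (a := fun k => a k + w) (b := fun k => b k + w)).
    move=> _ [x /Bab [k _ abx] <-]; exists k => // i.
    by have /andP[? ?] := abx i; rewrite !mxE ltrD2r lerD2r; apply/andP.
  apply: lee_nneseries => [k _ _|k _]; first by rewrite lee_fin box_vol_ge0.
  rewrite /box_vol lee_fin le_eqVlt; apply/orP; left; apply/eqP.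
  by apply: eq_bigr => i _; rewrite !mxE; congr Num.max; ring.
apply/eqP; rewrite eq_le le/=.
have {1}-> : A = translate (- v) (translate v A).
  apply/seteqP; split => [x Ax|_ [_ [x Ax <-] <-]]; last by rewrite addrK.
  by exists (x + v); [exists x|rewrite addrK].
exact: le.
Qed.

Lemma translate_preimage n (v : 'rV[R]_n) (A : set 'rV[R]_n) :
  translate v A = (fun x => x - v) @^-1` A.
Proof.
apply/seteqP; split => [_ [x Ax <-]|x Ax]; first by rewrite /= addrK.
by exists (x - v) => //; rewrite subrK.
Qed.

Lemma translate_borel n (v : 'rV[R]_n) (A : set (borelType R n)) :
  measurable A -> measurable (translate v (A : set 'rV[R]_n) : set (borelType R n)).
Proof.
move=> mA; rewrite translate_preimage.
apply: continuous_borel => // x B /nbhs_ballP[e /= e0 eB].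
apply/nbhs_ballP; exists e => // y; rewrite -ball_normE /= => xy.
by apply: eB; rewrite -ball_normE /= opprB addrA subrK.
Qed.

(** This replaces Fubini twice: with translates stacked vertically it bounds the volume of a strip,
    and with arbitrarily many translates in a bounded set it shows that sets of kinks are null. *)
Lemma disjoint_translates n (T : set (borelType R n.+1)) (v : nat -> 'rV[R]_n.+1)
    (Q : set 'rV[R]_n.+1) (J : nat) :
  measurable T -> trivIset `I_J (fun j => translate (v j) T) ->
  (forall j, (j < J)%N -> translate (v j) T `<=` Q) ->
  (J%:R%:E * @lebesgue R n.+1 T <= lebesgue Q)%E.
Proof.
move=> mT tT TQ.
apply: (@le_trans _ _ (lebesgue (\big[setU/set0]_(j < J) translate (v j) T))).
  have -> : lebesgue (\big[setU/set0]_(j < J) translate (v j) T) =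
    (\sum_(j < J) @borel_lebesgue R n (translate (v j) T))%E.
    rewrite -(@measure_semi_additive_ord_I _ _ _ (@borel_lebesgue R n)
     (fun j => translate (v j) T) J)//.
      by move=> j _; exact: translate_borel.
    by apply: bigsetU_measurable => j _; exact: translate_borel.
  rewrite (eq_bigr (fun=> lebesgue T)); last by move=> j _; exact: lebesgue_translate.
  by rewrite sumr_const card_ord mule_natl.
apply: le_lebesgue; rewrite -(bigcup_mkord J (fun j => translate (v j) T)).
by move=> x [j jJ] /TQ; exact.
Qed.

End Strips.

Section Fibres.
Variable R : realType.

Definition height n (X : 'rV[R]_(n + 1)) : R := X 0 (rshift n ord0).

Lemma height_pt n (x : 'rV[R]_n) t : height (pt x t) = t.
Proof. by rewrite /height /pt row_mxEr mxE. Qed.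

Lemma lsubmx_pt n (x : 'rV[R]_n) t : lsubmx (pt x t) = x.
Proof. exact: row_mxKl. Qed.

Lemma pt_eta n (X : 'rV[R]_(n + 1)) : pt (lsubmx X) (height X) = X.
Proof.
rewrite -[RHS]hsubmxK /pt; congr row_mx.
by apply/rowP => j; rewrite !mxE (ord1 j).
Qed.

Lemma boxE n (a b : 'rV[R]_(n + 1)) X : box a b X <->
  box (lsubmx a) (lsubmx b) (lsubmx X) /\ height a < height X <= height b.
Proof.
split=> [abX|[abX hX] i].
  by split=> [i|]; [have := abX (lshift 1 i); rewrite !mxE|exact: abX].
case: (splitP i) => j ij.
  by have := abX j; rewrite !mxE; have -> : lshift 1 j = i by exact/val_inj.
suff -> : i = rshift n ord0 by [].
by apply/val_inj; rewrite /= ij (ord1 j).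
Qed.

Lemma box_volE n (a b : 'rV[R]_(n + 1)) : box_vol a b =
  box_vol (lsubmx a) (lsubmx b) * Num.max 0 (height b - height a).
Proof.
rewrite /box_vol big_split_ord/= big_ord1; congr (_ * _).
by apply: eq_bigr => i _; rewrite !mxE.
Qed.

(* Markov's inequality for the function sending a base point to the total
   height of the boxes of a cover of [W] lying above it. *)
Lemma lebesgue_fibre_ge n (D : set 'rV[R]_n.+1) (W : set 'rV[R]_(n.+1 + 1))
    (al : 'rV[R]_n.+1 -> R) (c : R) : 0 < c ->
  (forall q h, D q -> al q < h < al q + c -> W (pt q h)) ->
  (c%:E * lebesgue D <= lebesgue W)%E.
Proof.
move=> c0 DW.
have [Woo|] := ltP (lebesgue W) +oo%E; last by rewrite leye_eq => /eqP ->; rewrite leey.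
apply/lee_addgt0Pr => e e0.
have [a [b [Wab abe]]] := lebesgue_adherent e0 Woo.
apply: le_trans abe.
pose B k : set (borelType R n.+1) := box (lsubmx (a k)) (lsubmx (b k)).
have mB k : measurable (B k) by exact: box_borel.
pose len k : R := Num.max 0 (height (b k) - height (a k)).
have len0 k : 0 <= len k by rewrite le_max lexx.
pose f k (q : borelType R n.+1) : \bar R := ((len k)%:E * (\1_(B k) q)%:E)%E.
pose F (q : borelType R n.+1) : \bar R := (\sum_(0 <= k <oo) f k q)%E.
have mf k : measurable_fun setT (f k).
  by apply: measurable_funeM; apply/measurable_EFinP; exact: measurable_indic.
have f0 k q : (0 <= f k q)%E.
  by rewrite mule_ge0// lee_fin// indicE; case: (_ \in _).
have mF : measurable_fun setT F.
  by apply: ge0_emeasurable_sum.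
pose S : set (borelType R n.+1) := setT `&` [set q | (c%:E <= F q)%E].
have mS : measurable S by exact: emeasurable_fun_c_infty.
have DS : D `<=` S.
  move=> q Dq; split => //=.
  (* [I k] is the slice over [q] of the box of index [k]. The slices cover an interval of length
     [c], and their lengths add up to [F q]. *)
  pose I k : set R := if q \in B k then `]height (a k), height (b k)]%classic else set0.
  have mI k : measurable (I k) by rewrite /I; case: ifP => _.
  have : (@lebesgue_measure R (`]al q, (al q + c)%R[%classic)%R <=
          \sum_(0 <= k <oo) @lebesgue_measure R (I k))%E.
    apply: measure_sigma_subadditive => // h; rewrite /= in_itv/= => hc.
    have [k _] := Wab _ (DW _ _ Dq hc).
    move=> /boxE[]; rewrite lsubmx_pt height_pt => Bq hab.
    by exists k => //; rewrite /I mem_set//= in_itv.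
  rewrite lebesgue_measure_itv/= lte_fin ltrDl c0 -EFinD addrAC subrr add0r.
  move/le_trans; apply; apply: lee_nneseries => // k _.
  rewrite /I /f indicE; case: ifP => _; last by rewrite measure0 mule0.
  rewrite mule1 lebesgue_measure_itv/= lte_fin /len.
  by case: ltP => ab; rewrite lee_fin le_max ?lexx ?orbT.
apply: (@le_trans _ _ (c%:E * borel_lebesgue S)%E).
  by rewrite lee_pmul2l// le_lebesgue.
rewrite -[X in (X <= _)%E]integral_cst//.
apply: (@le_trans _ _ (\int[@borel_lebesgue R n]_(q in S) F q)%E).
  apply: ge0_le_integral => //.
  - by move=> q _; rewrite lee_fin ltW.
  - exact: measurable_funTS.
  - by move=> q [_ cF].
rewrite integral_nneseries//; last by move=> k; exact: measurable_funTS.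
apply: lee_nneseries => [k _ _|k _]; first by apply: integral_ge0.
rewrite ge0_integralZl_EFin//; last by apply/measurable_EFinP; exact: measurable_indic.
rewrite integral_indic// box_volE mulrC EFinM lee_wpmul2l ?lee_fin//.
apply: le_trans (lebesgue_box _ _); apply: le_lebesgue.
exact: subIsetl.
Qed.

End Fibres.

Section Strip.
Variable R : realType.

(** Half-open in the vertical direction, so that translates by distinct multiples of [eta] are
    disjoint. *)
Definition strip n (E : set 'rV[R]_n) (g : 'rV[R]_n -> R) (eta : R) :
    set 'rV[R]_(n + 1) :=
  [set X | E (lsubmx X) /\ g (lsubmx X) <= height X < g (lsubmx X) + eta].

Lemma lsubmx_continuous n : continuous (lsubmx : 'rV[R]_(n + 1) -> 'rV[R]_n).
Proof. exact: continuous_lsubmx. Qed.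

Lemma height_continuous n : continuous (@height R n).
Proof. by move=> X; exact: coord_continuous. Qed.

Lemma strip_borel n (E : set (borelType R n)) (g : 'rV[R]_n -> R) (eta : R) :
  measurable E -> continuous g ->
  measurable (strip E g eta : set (borelType R (n + 1))).
Proof.
move=> mE cg.
pose f (X : 'rV[R]_(n + 1)) := height X - g (lsubmx X).
have cf : continuous f.
  move=> X; apply: continuousB; first exact: height_continuous.
  by apply: continuous_comp; [exact: lsubmx_continuous|exact: cg].
have -> : strip E g eta = (lsubmx @^-1` E `&` f @^-1` [set x | 0 <= x]) `&`
    f @^-1` [set x | x < eta].
  apply/seteqP; split => X; rewrite /strip /f /=.
    by move=> [EX /andP[? ?]]; repeat split => //; lra.
  by move=> [[EX ?] ?]; split => //; apply/andP; split; lra.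
apply: measurableI; first apply: measurableI.
- by apply: continuous_borel => //; exact: lsubmx_continuous.
- apply: closed_borel; apply: preimage_closed; last exact: closed_ge.
  by move=> X _; exact: cf.
- by apply: open_borel; apply: open_comp; [move=> X _; exact: cf|exact: open_lt].
Qed.

(* The translates of the strip by multiples of its thickness are disjoint and
   stack up, so that the variation of [g] over the box becomes negligible. *)
Lemma lebesgue_strip_box n (a b : 'rV[R]_n.+1) (g : 'rV[R]_n.+1 -> R) (L eta : R) :
  (forall x y, `|g x - g y| <= L * `|x - y|) -> 0 < eta ->
  (lebesgue (strip (box a b) g eta) <= (box_vol a b * eta)%:E)%E.
Proof.
move=> gL eta0; set T := strip _ _ _.
pose c := `|g a| + `|L| * `|b - a| + 1.
have c0 : 0 < c by rewrite ltr_wpDl// addr_ge0// mulr_ge0.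
have gc x : box a b x -> `|g x| < c.
  move=> abx; apply: (@le_lt_trans _ _ (`|g a| + `|g x - g a|)).
    by rewrite (le_trans _ (ler_normD _ _))// addrC subrK.
  rewrite /c -addrA ltrD2l (le_lt_trans (gL _ _))//.
  apply: (@le_lt_trans _ _ (`|L| * `|b - a|)); last by rewrite ltrDl.
  apply: (@le_trans _ _ (`|L| * `|x - a|)).
    by rewrite ler_wpM2r// ler_norm.
  apply: ler_wpM2l => //.
  apply: norm_le_coord => // i; rewrite !mxE.
  have /andP[ax xb] := abx i.
  rewrite ger0_norm; last by rewrite subr_ge0 ltW.
  apply: (le_trans _ (coord_le_norm (b - a) i)); rewrite !mxE.
  by rewrite (le_trans _ (ler_norm _))// lerB.
have mT : measurable (T : set (borelType R (n.+1 + 1))).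
  by apply: strip_borel; [exact: box_borel|exact: (lipschitz_continuous_fun gL)].
pose v (j : nat) : 'rV[R]_(n.+1 + 1) := pt 0 (j%:R * eta).
have lv (j : nat) X : lsubmx (X - v j) = lsubmx X.
  by rewrite raddfB/= lsubmx_pt subr0.
have hv (j : nat) X : height (X - v j) = height X - j%:R * eta.
  by rewrite /height mxE [X in _ + X]mxE -/(height (v j)) height_pt.
have TE (j : nat) X : translate (v j) T X <-> box a b (lsubmx X) /\
    g (lsubmx X) <= height X - j%:R * eta < g (lsubmx X) + eta.
  by rewrite translate_preimage /preimage/= /T /strip /= lv hv.
have bound (J : nat) :
    (J%:R%:E * lebesgue T <= (box_vol a b * (2 * c + J%:R * eta))%:E)%E.
  apply: (@le_trans _ _ (lebesgue (box (pt a (- c)) (pt b (c + J%:R * eta))))).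
    apply: (@disjoint_translates R (n + 1) T v) => //.
      move=> i j /= iJ jJ [X []] /TE[_ /andP[i1 i2]] /TE[_ /andP[j1 j2]].
      have lt_mul (k l : nat) : (k < l)%N -> k%:R * eta + eta <= l%:R * eta.
        by move=> kl; rewrite -[X in _ + X]mul1r -mulrDl ler_pM2r// natr1 ler_nat.
      by case: (ltngtP i j) => // /lt_mul ij; exfalso; lra.
    move=> j jJ X /TE[abX /andP[h1 h2]].
    apply/boxE; rewrite !lsubmx_pt !height_pt; split=> //.
    have := gc _ abX; rewrite ltr_norml => /andP[? ?].
    have : (j%:R + 1) * eta <= J%:R * eta.
      by rewrite ler_pM2r// natr1 ler_nat.
    have : 0 <= j%:R * eta by rewrite mulr_ge0// ltW.
    by move=> ? ?; apply/andP; split; lra.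
  apply: le_trans (lebesgue_box _ _) _.
  rewrite lee_fin (@box_volE R n.+1) !lsubmx_pt !height_pt.
  rewrite max_r; last first.
    have : 0 <= J%:R * eta by rewrite mulr_ge0// ltW.
    by move=> ?; lra.
  by apply: ler_wpM2l; [exact: box_vol_ge0|lra].
have Tfin : lebesgue T \is a fin_num.
  rewrite ge0_fin_numE ?lebesgue_ge0//.
  by have := bound 1%N; rewrite mul1e => /le_lt_trans; apply; rewrite ltry.
rewrite -(fineK Tfin) lee_fin.
have {}bound (J : nat) : J%:R * fine (lebesgue T) <= box_vol a b * (2 * c + J%:R * eta).
  by rewrite -lee_fin EFinM fineK.
rewrite leNgt; apply/negP; rewrite -subr_gt0 => d0.
set d := _ - _ in d0.
pose J := (Num.truncn (box_vol a b * (2 * c) / d)).+1.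
have : box_vol a b * (2 * c) / d < J%:R.
  exact: truncnS_gt.
rewrite ltr_pdivrMr// ltNge => /negP; apply.
by rewrite /d mulrBr; have := bound J; lra.
Qed.

Lemma lebesgue_strip_le n (E : set 'rV[R]_n.+1) (g : 'rV[R]_n.+1 -> R) (L eta : R) :
  (forall x y, `|g x - g y| <= L * `|x - y|) -> 0 < eta ->
  (lebesgue (strip E g eta) <= eta%:E * lebesgue E)%E.
Proof.
move=> gL eta0.
have [Eoo|] := ltP (lebesgue E) +oo%E; last first.
  by rewrite leye_eq => /eqP ->; rewrite gt0_muley ?lte_fin// leey.
rewrite muleC -lee_pdivrMr//; apply/lee_addgt0Pr => e e0.
have [a [b [Eab abe]]] := lebesgue_adherent e0 Eoo.
apply: le_trans abe; rewrite lee_pdivrMr//.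
apply: (@le_trans _ _ (\sum_(0 <= k <oo) lebesgue (strip (box (a k) (b k)) g eta))%E).
  apply: le_trans (outer_measure_sigma_subadditive (@lebesgue R (n + 1).+1) _).
  apply: le_lebesgue => X [/Eab[k _ abX] hX]; exists k => //.
rewrite muleC -nneseriesZl//; last by move=> k _; rewrite lee_fin box_vol_ge0.
apply: lee_nneseries => [k _ _|k _]; first exact: lebesgue_ge0.
by rewrite -EFinM mulrC; exact: lebesgue_strip_box gL eta0.
Qed.

End Strip.

(** * Compact sets and regularity of Borel measures *)

Section Thickening.
Variable R : realType.

(** The predicate depends on [r] so that one statement yields both uniform neighbourhoods, with [r]
    as radius, and uniform bounds, with [r^-1] as bound. *)
Lemma compact_uniform_radius n (k : set 'rV[R]_n) (P : 'rV[R]_n -> R -> Prop) :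
  compact k ->
  (forall x, k x -> exists2 e, 0 < e &
     forall y r, `|x - y| < e -> 0 < r < e -> P y r) ->
  exists2 e, 0 < e & forall x r, k x -> 0 < r < e -> P x r.
Proof.
move=> /compact_near_coveringP ck kP.
have [|e /= e0 eP] := ck R (0^'+) (fun r y => P y r) _.
  move=> x /kP[e e0 eP].
  exists (ball x e, [set r | 0 < r < e]).
    split; first exact: nbhsx_ballx.
    exists e => //= r; rewrite /ball/= sub0r normrN => re r0.
    by rewrite r0/= (le_lt_trans (ler_norm _) re).
  by move=> [y r] [/=]; rewrite -ball_normE => /= ? ?; exact: eP.
exists e => // x r kx /andP[r0 re]; apply: eP => //.
by rewrite /ball/= sub0r normrN gtr0_norm.
Qed.

Definition thickening n (k : set 'rV[R]_n) (r : R) : set 'rV[R]_n :=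
  [set x | exists2 p, k p & `|x - p| <= r].

Lemma norm_ball_compact n (r : R) : compact [set x : 'rV[R]_n | `|x| <= r].
Proof.
apply: bounded_closed_compact.
  by exists r; split; [exact: num_real|move=> s rs x /= /le_trans -> //; exact: ltW].
rewrite (_ : mkset _ = (fun x : 'rV[R]_n => `|x|) @^-1` [set s | s <= r])//.
by apply: preimage_closed; [move=> x _; exact: norm_continuous|exact: closed_le].
Qed.

Lemma thickening_compact n (k : set 'rV[R]_n) r : compact k -> compact (thickening k r).
Proof.
move=> ck.
have -> : thickening k r =
    (fun z : 'rV[R]_n * 'rV[R]_n => z.1 + z.2) @` (k `*` [set x | `|x| <= r]).
  apply/seteqP; split => [x [p kp xp]|_ [[p v] [/= kp vr] <-]].
    by exists (p, x - p) => //=; rewrite addrC subrK.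
  by exists p => //; rewrite addrC addKr.
apply: continuous_compact; last by apply: compact_setX => //; exact: norm_ball_compact.
by apply: continuous_subspaceT; exact: add_continuous.
Qed.

Lemma compact_thickening_subset n (k O : set 'rV[R]_n) : compact k -> open O ->
  k `<=` O -> exists2 r, 0 < r & thickening k r `<=` O.
Proof.
move=> ck oO kO.
have [|e e0 eP] := @compact_uniform_radius n k
    (fun y r => forall z, `|z - y| <= r -> O z) ck.
  move=> x kx; have /nbhs_ballP[e /= e0 eO] := open_nbhs_nbhs (conj oO (kO _ kx)).
  exists (e / 2); first by rewrite divr_gt0.
  move=> y r xy /andP[r0 re] z zy; apply: eO; rewrite -ball_normE /=.
  rewrite (splitr e) -(subrK y x) -addrA (le_lt_trans (ler_normD _ _))// ltrD//.
  by rewrite distrC (le_lt_trans zy).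
exists (e / 2); first by rewrite divr_gt0.
move=> z [x kx zx]; apply: (eP x (e / 2)) => //.
by rewrite divr_gt0//= ltr_pdivrMr// mulrDr mulr1 ltrDl.
Qed.

Lemma bigcap_thickening n (k : set 'rV[R]_n) : closed k ->
  \bigcap_j thickening k (j.+1%:R^-1) = k.
Proof.
move=> ck; apply/seteqP; split => [x kx|x kx j _]; last first.
  by exists x => //; rewrite subrr normr0.
apply: ck => B /nbhs_ballP[e /= e0 eB].
have [j je] : exists j : nat, j.+1%:R^-1 < e.
  exists (Num.truncn e^-1); rewrite invf_plt ?posrE//; exact: truncnS_gt.
have [p kp xp] := kx j I; exists p; split => //; apply: eB.
by rewrite -ball_normE /= (le_lt_trans xp).
Qed.

(** Continuity from above along the thickenings of radius [1/(j+1)]; the first of them is bounded,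
    hence of finite measure. *)
Lemma lebesgue_thickening n (k : set 'rV[R]_n.+1) (c : \bar R) : compact k ->
  (forall r : R, 0 < r -> (c <= lebesgue (thickening k r))%E) -> (c <= lebesgue k)%E.
Proof.
move=> ck kc.
have cl : closed k by exact: compact_closed_rV.
pose F (j : nat) : set (borelType R n.+1) := thickening k (j.+1%:R^-1).
have mF j : measurable (F j) by apply: compact_borel; exact: thickening_compact.
have cF : (@borel_lebesgue R n) \o F @ \oo --> @borel_lebesgue R n (\bigcap_j F j).
  apply: nonincreasing_cvg_mu => //.
  - have [M [Mr Mk]] := compact_bounded (thickening_compact (r := 1) ck).
    pose m := M + 1.
    have Mm : M < m by rewrite ltrDl.
    (* The lower corner is [-(m + 1)] because a box excludes its lower faces. *)
    pose Q : set 'rV[R]_n.+1 := box (const_mx (- (m + 1))) (const_mx m).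
    apply: (@le_lt_trans _ _ (lebesgue Q)).
      apply: le_lebesgue => x; rewrite /F invr1 => /(Mk m Mm) /= xm.
      move=> i; rewrite !mxE; have := le_trans (coord_le_norm x i) xm.
      by rewrite ler_norml => /andP[? ?]; apply/andP; split; lra.
    by apply: le_lt_trans (lebesgue_box _ _) _; rewrite ltry.
  - by apply: bigcap_measurable => //; exists 0%N.
  - move=> i j ij; apply/subsetPset => x [p kp xp]; exists p => //.
    by rewrite (le_trans xp)// lef_pV2 ?posrE// ler_nat.
have : (c <= @borel_lebesgue R n (\bigcap_j F j))%E.
  apply: cvge_ge cF; apply: nearW => j; exact: kc.
by rewrite bigcap_thickening.
Qed.

End Thickening.

Section Regularity.
Variables (R : realType) (n : nat).
Local Notation B := (borelType R n).
Implicit Types mu : {measure set B -> \bar R}.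

(** The points at distance at least [1/(j+1)] from the complement of [U]. Removing a union of open
    balls makes it visibly closed and needs no convention for an empty complement. *)
Definition closed_core (U : set 'rV[R]_n) (j : nat) : set 'rV[R]_n :=
  ~` \bigcup_(z in ~` U) ball z (j.+1%:R^-1).

Lemma closed_coreP (U : set 'rV[R]_n) : open U ->
  [/\ forall j, closed (closed_core U j), forall j, closed_core U j `<=` U,
      nondecreasing_seq (closed_core U) & \bigcup_j closed_core U j = U].
Proof.
move=> oU.
have coreU j : closed_core U j `<=` U.
  move=> x; rewrite /closed_core; apply: contra_notP => Ux; exists x => //.
  exact: ballxx.
split => //.
- by move=> j; apply: open_closedC; apply: bigcup_open => z _; exact: ball_open.
- move=> i j ij; apply/subsetPset; apply: subsetC => x [z Uz zx]; exists z => //.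
  by apply: le_ball zx; rewrite lef_pV2 ?posrE// ler_nat.
apply/seteqP; split => [x [j _ /coreU]//|x Ux].
have /nbhs_ballP[e /= e0 eU] := open_nbhs_nbhs (conj oU Ux).
have [j je] : exists j : nat, j.+1%:R^-1 < e.
  exists (Num.truncn e^-1); rewrite invf_plt ?posrE//; exact: truncnS_gt.
exists j => // -[z Uz zx]; apply: Uz; apply: eU.
by apply: ball_sym; apply: le_ball zx; exact: ltW.
Qed.

Definition closed_open_approx mu (b : set B) := forall e : R, 0 < e ->
  exists F U : set 'rV[R]_n, [/\ closed F, open U, F `<=` b, b `<=` U &
    (mu (U `\` F : set B) <= e%:E)%E].

(** The sets with such approximations form a sigma-algebra containing the open sets. Approximating
    from both sides at once makes the complement immediate. *)
Lemma borel_closed_open_approx mu (b : set B) :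
  (mu setT < +oo)%E -> measurable b -> closed_open_approx mu b.
Proof.
move=> muT; move: b.
have mu_fin (A : set B) : measurable A -> (mu A < +oo)%E.
  by move=> mA; apply: le_lt_trans muT; apply: le_measure; rewrite ?inE.
have small (A : nat -> set B) (e : R) : (forall j, measurable (A j)) ->
    nonincreasing_seq A -> \bigcap_j A j = set0 -> 0 < e -> exists j, (mu (A j) <= e%:E)%E.
  move=> mA nA A0 e0.
  have : mu \o A @ \oo --> mu (\bigcap_j A j).
    apply: nonincreasing_cvg_mu => //; first exact: mu_fin.
    by rewrite A0; exact: measurable0.
  rewrite A0 measure0 => /fine_cvgP[_ /cvgrPdist_le /(_ _ e0)[j _ /(_ j (leqnn j))]] /=.
  rewrite sub0r normrN => je; exists j.
  rewrite -(@fineK _ (mu (A j))) ?lee_fin ?ge0_fin_numE ?mu_fin//.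
  by rewrite (le_trans (ler_norm _)).
apply: smallest_sub => [|U oU e e0]; last first.
  have [cF FU ndF UF] := closed_coreP oU.
  have [j je] : exists j, (mu (U `\` closed_core U j : set B) <= e%:E)%E.
    apply: small => //.
    - by move=> j; apply: measurableD; [exact: open_borel|exact: closed_borel].
    - by move=> i j ij; apply/subsetPset; apply: setDS; apply/subsetPset/ndF.
    - rewrite -subset0 => x Ux; have [Ux0 _] := Ux 0%N I.
      by move: Ux0; rewrite -{1}UF => -[j _ xj]; have [_] := Ux j I.
  by exists (closed_core U j), U; split.
split => [e e0|A Areg e e0|A Areg e e0].
- exists set0, set0; split;
    [exact: closed0|exact: open0|by []|by []|by rewrite setD0 measure0 lee_fin ltW].
- have [F [U [cF oU FA AU UF]]] := Areg _ e0.
  exists (~` U), (~` F); split.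
  + exact: open_closedC.
  + exact: closed_openC.
  + by rewrite setTD; exact: subsetC.
  + by rewrite setTD; exact: subsetC.
  + by rewrite setDE setCK setIC -setDE.
have e20 : 0 < e / 2 by rewrite divr_gt0.
have /choice[F FP] j : exists F : set 'rV[R]_n, exists U : set 'rV[R]_n,
    [/\ closed F, open U, F `<=` A j, A j `<=` U &
    (mu (U `\` F : set B) <= (e / 2 / (2 ^ j.+1)%:R)%:E)%E].
  by apply: Areg; rewrite divr_gt0// ltr0n expn_gt0.
have /choice[U UP] := FP.
(* A countable union of closed sets need not be closed, so it is cut to the finite union [G k]. One
   half of [e] pays for the cut, the other for the differences of [U j] and [F j]. *)
pose V := \bigcup_j U j; pose G k := \big[setU/set0]_(j < k.+1) F j.
have mV : measurable (V : set B).
  by apply: open_borel; apply: bigcup_open => j _; have [] := UP j.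
have cG k : closed (G k).
  rewrite /G; elim/big_ind: _ => [|? ?|j _]; [exact: closed0|exact: closedU|].
  by have [] := UP j.
have mG k : measurable (G k : set B) by apply: closed_borel.
have FG : \bigcup_k G k = \bigcup_j F j by rewrite /G bigcup_bigsetU_bigcup.
have muVF : (mu (V `\` \bigcup_j F j : set B) <= (e / 2)%:E)%E.
  apply: (@le_trans _ _ (\sum_(0 <= j <oo) mu (U j `\` F j : set B))%E).
    apply: measure_sigma_subadditive => [j||x [[j _ Ujx] Fx]].
    - by have [? ? _ _ _] := UP j; apply: measurableD; [exact: open_borel|exact: closed_borel].
    - apply: measurableD => //; apply: bigcup_measurable => j _.
      by apply: closed_borel; have [] := UP j.
    - by exists j => //; split => // Fjx; apply: Fx; exists j.
  apply: le_trans (@epsilon_trick0 R (e / 2) xpredT (ltW e20)).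
  by apply: lee_nneseries => // j _; have [] := UP j.
have [k ke] : exists k, (mu ((\bigcup_j F j) `\` G k : set B) <= (e / 2)%:E)%E.
  apply: small => //.
  - move=> j; apply: measurableD => //; apply: bigcup_measurable => i _.
    by apply: closed_borel; have [] := UP i.
  - move=> i j ij; apply/subsetPset; apply: setDS; exact: subset_bigsetU.
  - rewrite -subset0 => x Ux; have [] := Ux 0%N I.
    by rewrite -FG => -[j _ xj]; have [_] := Ux j I.
exists (G k), V; split => //.
- by apply: bigcup_open => j _; have [] := UP j.
- rewrite /G -bigcup_mkord => x [j /= jk Fjx]; exists j => //.
  by have [_ _ + _ _] := UP j; exact.
- by move=> x [j _ Ajx]; exists j => //; have [_ _ _ + _] := UP j; exact.
have mF : measurable (\bigcup_j F j : set B).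
  by apply: bigcup_measurable => j _; apply: closed_borel; have [] := UP j.
have mVF : measurable (V `\` \bigcup_j F j : set B) by exact: measurableD.
have mFG : measurable (\bigcup_j F j `\` G k : set B) by exact: measurableD.
apply: le_trans (le_trans (@measureU2 _ _ _ mu _ _ mVF mFG) _).
  apply: le_measure; rewrite ?inE; [exact: measurableD|exact: measurableU|].
  by move=> x [Vx Gx]; have [?|?] := pselect ((\bigcup_j F j) x); [right|left].
by rewrite [e in leRHS](splitr e) EFinD leeD.
Qed.

(** Since [mu] is known to be finite only on compact subsets of [O], it is restricted to an open [V]
    with [k] inside and a compact [c] of [O] around it. That [c] is returned because later maxima
    are taken over it. *)
Lemma borel_compact_open_approx mu (O k : set 'rV[R]_n) (b : set B) (e : R) :
  (forall c : set 'rV[R]_n, compact c -> c `<=` O -> (mu (c : set B) < +oo)%E) ->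
  open O -> compact k -> k `<=` O -> measurable b -> b `<=` k -> 0 < e ->
  exists F U c : set 'rV[R]_n, [/\ compact F, open U, F `<=` b, b `<=` U &
    [/\ U `<=` c, compact c, c `<=` O & (mu (U `\` F : set B) <= e%:E)%E]].
Proof.
move=> mu_fin oO ck kO mb bk e0.
have [r r0 rO] := compact_thickening_subset ck oO kO.
pose c := thickening k r.
have cc : compact c by exact: thickening_compact.
pose V : set 'rV[R]_n := \bigcup_(p in k) ball p r.
have oV : open V by apply: bigcup_open => p _; exact: ball_open.
have Vc : V `<=` c.
  by move=> x [p kp]; rewrite -ball_normE /= => /ltW px; exists p; rewrite // distrC.
have mV : measurable (V : set B) by exact: open_borel.
have muV : (mrestr mu mV setT < +oo)%E.
  rewrite /mrestr setTI; apply: le_lt_trans (mu_fin c cc rO).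
  by apply: le_measure; rewrite ?inE//; exact: compact_borel.
have [F [U [cF oU Fb bU UF]]] := borel_closed_open_approx muV mb e0.
exists F, (U `&` V), c; split => //.
- by apply: subclosed_compact ck _ => //; exact: subset_trans bk.
- exact: openI.
- by move=> x bx; split; [exact: bU|exists x; [exact: bk|exact: ballxx]].
- split => //; first by move=> x [_ /Vc].
  by suff <- : (U `\` F) `&` V = (U `&` V) `\` F by []; rewrite !setDE setIAC.
Qed.

End Regularity.

(** * Convex geometry of the domain *)

Section Dot.
Variables (R : realType) (n : nat).
Implicit Types x y z : 'rV[R]_n.

Lemma dotE x y : dot x y = \sum_i x 0 i * y 0 i.
Proof. by rewrite /dot mxE; apply: eq_bigr => i _; rewrite mxE. Qed.

Lemma dotC x y : dot x y = dot y x.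
Proof. by rewrite !dotE; apply: eq_bigr => i _; rewrite mulrC. Qed.

Lemma dotDl x y z : dot (x + y) z = dot x z + dot y z.
Proof. by rewrite /dot mulmxDl mxE. Qed.

Lemma dotDr x y z : dot x (y + z) = dot x y + dot x z.
Proof. by rewrite dotC dotDl !(dotC x). Qed.

Lemma dotZl a x y : dot (a *: x) y = a * dot x y.
Proof. by rewrite /dot -scalemxAl mxE. Qed.

Lemma dotZr a x y : dot x (a *: y) = a * dot x y.
Proof. by rewrite dotC dotZl dotC. Qed.

Lemma dotNl x y : dot (- x) y = - dot x y.
Proof. by rewrite -scaleN1r dotZl mulN1r. Qed.

Lemma dotNr x y : dot x (- y) = - dot x y.
Proof. by rewrite dotC dotNl dotC. Qed.

Lemma dotBl x y z : dot (x - y) z = dot x z - dot y z.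
Proof. by rewrite dotDl dotNl. Qed.

Lemma dotBr x y z : dot x (y - z) = dot x y - dot x z.
Proof. by rewrite dotDr dotNr. Qed.

Lemma dot0l x : dot 0 x = 0.
Proof. by rewrite /dot mul0mx mxE. Qed.

Lemma dot0r x : dot x 0 = 0.
Proof. by rewrite dotC dot0l. Qed.

Lemma dot_delta x i : dot x (delta_mx 0 i) = x 0 i.
Proof.
rewrite dotE (bigD1 i)//= big1 => [|j ji]; first by rewrite mxE !eqxx mulr1 addr0.
by rewrite mxE (negbTE ji) andbF mulr0.
Qed.

Lemma norm_delta_mx i : `|delta_mx 0 i : 'rV[R]_n| = 1.
Proof.
apply/eqP; rewrite eq_le; apply/andP; split.
  apply: norm_le_coord => // j.
  by rewrite mxE eqxx/=; case: (_ == _); rewrite ?normr1 ?normr0.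
by apply: le_trans (coord_le_norm _ i); rewrite mxE !eqxx normr1.
Qed.

Lemma dot_norm_le x y : `|dot x y| <= n%:R * (`|x| * `|y|).
Proof.
rewrite dotE; apply: le_trans (ler_norm_sum _ _ _) _.
apply: (@le_trans _ _ (\sum_(i < n) `|x| * `|y|)).
  apply: ler_sum => i _; rewrite normrM.
  by apply: ler_pM => //; exact: coord_le_norm.
by rewrite sumr_const card_ord mulr_natl.
Qed.

Lemma dot_sqr_ge x : `|x| ^+ 2 <= dot x x.
Proof.
have dx0 : 0 <= dot x x by rewrite dotE sumr_ge0// => i _; rewrite -expr2 sqr_ge0.
rewrite -[leRHS]sqr_sqrtr// ler_pXn2r ?nnegrE ?sqrtr_ge0//.
apply: norm_le_coord => [|i]; first exact: sqrtr_ge0.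
rewrite -sqrtr_sqr ler_wsqrtr// dotE (bigD1 i)//= -expr2 lerDl sumr_ge0// => j _.
by rewrite -expr2 sqr_ge0.
Qed.

Lemma dot_continuous y : continuous (fun x : 'rV[R]_n => dot x y).
Proof.
apply: (@lipschitz_continuous_fun R _ _ (n%:R * `|y|)) => x z.
by rewrite -dotBl (le_trans (dot_norm_le _ _))// mulrAC mulrA.
Qed.

Lemma closure_convex_comb (K : set 'rV[R]_n) x k t :
  (forall x y t, K x -> K y -> 0 <= t <= 1 -> K ((1 - t) *: x + t *: y)) ->
  closure K x -> K k -> 0 <= t <= 1 -> closure K ((1 - t) *: x + t *: k).
Proof.
move=> cK clx Kk t01 A /nbhs_ballP[e /= e0 eA].
have [z [Kz]] := clx _ (nbhsx_ballx x e e0).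
rewrite -ball_normE /= => xz.
exists ((1 - t) *: z + t *: k); split; first exact: cK.
apply: eA; rewrite -ball_normE /= opprD addrACA subrr addr0 -scalerBr normrZ.
have /andP[t0 t1] := t01.
rewrite ger0_norm ?subr_ge0//; apply: le_lt_trans xz.
by rewrite ler_piMl// lerBlDr lerDl.
Qed.

(** The covector is [P - x0], where [x0] is the point of the closure nearest to [P] for the
    Euclidean form [f]. Row vectors carry the maximum norm, which [dot_sqr_ge] compares with [f]. *)
Lemma separate_point (K : set 'rV[R]_n) P :
  (forall x y t, K x -> K y -> 0 <= t <= 1 -> K ((1 - t) *: x + t *: y)) ->
  K !=set0 -> ~ closure K P ->
  exists phi c, (forall X, K X -> dot X phi <= c) /\ c < dot P phi.
Proof.
move=> cK [X1 KX1] nP.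
pose f X := dot (X - P) (X - P).
(* As [rho >= 1], a point at distance more than [rho] from [P] has [f] above [rho ^ 2 >= rho > f X1]
   and cannot compete for the minimum. *)
pose rho := f X1 + 1.
have fX1 : 0 <= f X1 by apply: le_trans (dot_sqr_ge _); exact: sqr_ge0.
have cf : continuous f.
  have -> : f = (fun X : 'rV[R]_n => \sum_i (X 0 i - P 0 i) * (X 0 i - P 0 i)).
    by apply/funext => X; rewrite /f dotE; apply: eq_bigr => i _; rewrite !mxE.
  apply: continuous_big => [|i _ X]; first exact: add_continuous.
  have cc : {for X, continuous (fun X : 'rV[R]_n => X 0 i - P 0 i)}.
    by apply: continuousB; [exact: coord_continuous|exact: cst_continuous].
  exact: (continuousM cc cc).
pose A := closure K `&` thickening [set P] rho.
have inA X : closure K X -> f X <= f X1 -> A X.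
  move=> clX fX; split => //; exists P => //.
  rewrite leNgt; apply/negP => rX.
  suff : rho < f X by rewrite ltNge (le_trans fX)// lerDl.
  apply: lt_le_trans (dot_sqr_ge _); rewrite expr2.
  apply: (lt_trans rX); rewrite ltr_pMl; first by apply: le_lt_trans rX; rewrite lerDr.
  by apply: le_lt_trans rX; rewrite addr_ge0.
have cA : compact A.
  have cT : compact (thickening [set P] rho).
    by apply: thickening_compact; exact: compact_set1.
  apply: (subclosed_compact _ cT) => [|X []//].
  apply: closedI; first exact: closed_closure.
  exact: (compact_closed_rV cT).
have [||x0 + x0min] := @EVT_min_rV _ _ f A _ cA.
- by exists X1; apply: inA => //; exact: subset_closure.
- by apply: continuous_subspaceT.
rewrite inE => -[clx0 _].
have {}x0min X : closure K X -> f x0 <= f X.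
  move=> clX; have [fX|/ltW fX] := leP (f X) (f X1).
    by apply: x0min; rewrite inE; exact: inA.
  apply: le_trans fX; apply: x0min; rewrite inE; apply: inA => //.
  exact: subset_closure.
exists (P - x0), (dot x0 (P - x0)); split => [X KX|]; last first.
  rewrite -subr_gt0 -dotBl.
  apply: lt_le_trans (dot_sqr_ge _); rewrite exprn_gt0// normr_gt0 subr_eq0.
  by apply/eqP => Px0; apply: nP; rewrite Px0.
rewrite -subr_le0 -dotBl leNgt; apply/negP.
rewrite -(opprB x0 P) dotNr; set w := x0 - P; set u := X - x0; set a := - _ => a0.
pose q := dot u u.
have q0 : 0 <= q by apply: le_trans (dot_sqr_ge _); exact: sqr_ge0.
(* Moving from [x0] towards [X] by the fraction [t] changes [f] by [t * (t * q - 2 * a)], which is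
   negative once [t * q < a]. *)
pose t := Num.min 1 (a / (q + 1)).
have t0 : 0 < t by rewrite lt_min ltr01 divr_gt0// ltr_wpDl.
have t1 : t <= 1 by rewrite ge_min lexx.
have tq : t * q < a.
  have q1 : t * (q + 1) <= a by rewrite -ler_pdivlMr ?ltr_wpDl// ge_min lexx orbT.
  by apply: lt_le_trans q1; rewrite mulrDr mulr1 ltrDl.
have clu : closure K ((1 - t) *: x0 + t *: X).
  by apply: closure_convex_comb => //; rewrite t1 ltW.
have := x0min _ clu.
have -> : (1 - t) *: x0 + t *: X = x0 + t *: u.
  by rewrite scalerBl scale1r scalerBr -addrA (addrC (- _)).
rewrite /f (addrAC x0) -/w (dotDl w) !(dotDr _ w) !dotZl !dotZr -/q (dotC w u).
rewrite -[X in X <= _]addr0 -addrA lerD2l => h.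
have : t * (t * q - a - a) < 0 by rewrite pmulr_rlt0//; lra.
by rewrite ltNge => /negP; apply; rewrite /a; lra.
Qed.

End Dot.

Section Convexity.
Variables (R : realType) (n : nat).

Lemma convex_set_comb (K : set 'rV[R]_n) : convex_set K ->
  forall x y t, K x -> K y -> 0 <= t <= 1 -> K ((1 - t) *: x + t *: y).
Proof.
move=> cK x y t Kx Ky /andP[t0 t1].
have := cK y x (Itv01 t0 t1); rewrite !inE => /(_ Ky Kx).
by rewrite /conv/= addrC.
Qed.

Lemma convex_function_comb (D : set 'rV[R]_n) (f : 'rV[R]_n -> R) :
  @convex_function R 'rV[R]_n D f ->
  forall x y t, D x -> D y -> 0 <= t <= 1 ->
    f ((1 - t) *: x + t *: y) <= (1 - t) * f x + t * f y.
Proof.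
move=> cf x y t Dx Dy /andP[t0 t1].
have := cf (Itv01 t0 t1) y x; rewrite !inE => /(_ Dy Dx).
by rewrite /conv/= addrC [leRHS]addrC.
Qed.

End Convexity.

(** * The polar of [Omega] and the dual cone *)

Section Polar.
Variables (R : realType) (d : nat) (Omega : set 'rV[R]_d).
Hypotheses (Omega_open : open Omega) (Omega_bounded : bounded_set Omega).
Hypothesis Omega0 : Omega 0.
Local Notation Os := (polar Omega).

Lemma closure_bounded : exists2 M : R, 0 < M & forall x, closure Omega x -> `|x| <= M.
Proof.
have [M [_ OM]] := Omega_bounded.
pose m := Num.max (M + 1) 1.
have m0 : 0 < m by rewrite lt_max ltr01 orbT.
exists m => // x; have : closed [set x : 'rV[R]_d | `|x| <= m].
  exact: (compact_closed_rV (@norm_ball_compact R d m)).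
move/closure_id => cl clx.
have : closure [set x : 'rV[R]_d | `|x| <= m] x.
  apply: closure_subset clx => z /(OM m) /=; apply.
  by rewrite lt_max ltrDl ltr01.
by rewrite -cl.
Qed.

Lemma polar0 : Os 0.
Proof. by move=> x _; rewrite dot0r. Qed.

Lemma polar_comb x y t : Os x -> Os y -> 0 <= t <= 1 -> Os ((1 - t) *: x + t *: y).
Proof.
move=> Ox Oy /andP[t0 t1] z clz; rewrite dotDr !dotZr.
have := Ox _ clz; have := Oy _ clz.
have [->|t0'] := eqVneq t 0; first by rewrite subr0 mul1r mul0r addr0.
move=> yz xz.
have : t * dot z y < t by rewrite gtr_pMr// lt_def t0'.
have : (1 - t) * dot z x <= 1 - t by rewrite ler_piMr ?subr_ge0// ltW.
by move=> ? ?; lra.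
Qed.

Lemma polar_contract y t : (forall x, Omega x -> dot x y <= 1) -> 0 < t <= 1 ->
  Os ((1 - t) *: y).
Proof.
move=> Oy /andP[t0 t1] x clx; rewrite dotZr.
have : dot x y <= 1.
  have cl : closed [set x : 'rV[R]_d | dot x y <= 1].
    rewrite (_ : mkset _ = (fun x : 'rV[R]_d => dot x y) @^-1` [set s | s <= 1])//.
    by apply: preimage_closed; [move=> z _; exact: dot_continuous|exact: closed_le].
  have : closure [set x : 'rV[R]_d | dot x y <= 1] x.
    by apply: closure_subset clx => z /Oy.
  by rewrite -(closure_id _).1.
move=> xy; have : (1 - t) * dot x y <= 1 - t by rewrite ler_piMr ?subr_ge0.
by move=> ?; lra.
Qed.

(** On the compact closure of [Omega] the maximum of [dot x y] is attained, hence below 1; the gap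
    [g] absorbs a small change of [y]. *)
Lemma polar_open : open Os.
Proof.
rewrite openE => y Oy.
have [M M0 OM] := closure_bounded.
have cO : compact (closure Omega).
  apply: bounded_closed_compact; last exact: closed_closure.
  by exists M; split; [exact: num_real|move=> s Ms x /OM xM; exact: le_trans xM (ltW Ms)].
have O0 : closure Omega !=set0 by exists 0; exact: subset_closure.
have [|x0] := @EVT_max_rV _ _ (fun x => dot x y) _ O0 cO.
  by apply: continuous_subspaceT; exact: dot_continuous.
rewrite inE => clx0 xmax.
pose g := 1 - dot x0 y.
have g0 : 0 < g by rewrite subr_gt0; exact: Oy.
apply/nbhs_ballP; exists (g / (d%:R * M + 1)) => /=.
  by rewrite divr_gt0// ltr_wpDl// mulr_ge0// ltW.
move=> z; rewrite -ball_normE /= ltr_pdivlMr; last first.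
  by rewrite ltr_wpDl// mulr_ge0// ltW.
move=> yz x clx.
have xx0 : dot x y <= dot x0 y by apply: xmax; rewrite inE.
have : `|dot x (z - y)| <= `|y - z| * (d%:R * M + 1).
  apply: le_trans (dot_norm_le _ _) _; rewrite distrC mulrA mulrC ler_wpM2l//.
  by apply: (@le_trans _ _ (d%:R * M)); [rewrite ler_wpM2l// OM|rewrite lerDl].
rewrite ler_norml dotBr => /andP[_ h].
by have := le_lt_trans h yz; rewrite /g; lra.
Qed.

Lemma polar_bounded : exists2 M : R, 0 < M & forall y, Os y -> `|y| <= M.
Proof.
have /nbhs_ballP[e /= e0 eO] := open_nbhs_nbhs (conj Omega_open Omega0).
have Oin (x : 'rV[R]_d) : `|x| < e -> closure Omega x.
  by move=> xe; apply/subset_closure/eO; rewrite -ball_normE /= sub0r normrN.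
exists ((e / 2)^-1); first by rewrite invr_gt0 divr_gt0.
move=> y Oy; apply: norm_le_coord => [|i].
  by rewrite invr_ge0 divr_ge0// ltW.
have e2 : 0 < e / 2 by rewrite divr_gt0.
have ei (s : R) : `|s| = e / 2 -> s * y 0 i < 1.
  move=> se; rewrite -dot_delta dotC -dotZl; apply: Oy; apply: Oin.
  rewrite normrZ se norm_delta_mx mulr1.
  by rewrite ltr_pdivrMr// mulrDr mulr1 ltrDl.
have := ei (e / 2); rewrite gtr0_norm// => /(_ erefl) h1.
have := ei (- (e / 2)); rewrite normrN gtr0_norm// => /(_ erefl) h2.
rewrite -(@ler_pM2l _ (e / 2))// mulfV ?gt_eqF//.
by case: (leP 0 (y 0 i)) => y0; [rewrite ger0_norm//|rewrite ltr0_norm//]; lra.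
Qed.

Lemma dot_pt n (p y : 'rV[R]_n) h t : dot (pt p h) (pt y t) = dot p y + h * t.
Proof. by rewrite /dot /pt tr_row_mx mul_row_col mxE !mxE big_ord1 !mxE. Qed.

Lemma polar_dual y : Os y -> proj_points (dual_cone (cone_over Omega)) (pt y (- 1)).
Proof.
move=> Oy; split.
  apply/eqP => /(congr1 (@height _ _)); rewrite height_pt /height mxE => /eqP.
  by rewrite oppr_eq0 oner_eq0.
exists 1; first exact: oner_neq0.
rewrite scale1r /dual_cone.
pose tau (phi : 'rV[R]_(d + 1)) := - height phi.
have ctau : continuous tau by move=> X; apply: continuousN; exact: height_continuous.
have /nbhs_ballP[e /= e0 eO] := open_nbhs_nbhs (conj polar_open Oy).
have [M M0 OM] := closure_bounded.
(* [g] is the affine chart sending the class of [(y, -1)] to [y]. Covectors near [(y, -1)] keep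
   [tau] positive and land in the open polar, which gives the interior in [dual_cone]. *)
pose g (phi : 'rV[R]_(d + 1)) : 'rV[R]_d := (tau phi)^-1 *: lsubmx phi.
have t1 : tau (pt y (- 1)) = 1 by rewrite /tau height_pt opprK.
have cg : {for pt y (- 1), continuous g}.
  apply: continuousZ; last exact: lsubmx_continuous.
  by apply: continuousV; [rewrite t1 oner_neq0|exact: ctau].
have n1 : nbhs (pt y (- 1)) (g @^-1` Os).
  apply: cg; rewrite /g t1 invr1 scale1r lsubmx_pt.
  exact: (open_nbhs_nbhs (conj polar_open Oy)).
have n2 : nbhs (pt y (- 1)) (tau @^-1` [set s | 0 < s]).
  apply: ctau; rewrite t1; apply: open_nbhs_nbhs; split; first exact: open_gt.
  exact: ltr01.
apply: filterS (filterI n1 n2) => phi [/= Og tau0] _ [t [x [t0 Ox ->]]].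
rewrite dotC dotZl -(pt_eta phi) dot_pt mul1r -[height phi]opprK -/(tau phi).
have := Og _ (subset_closure Ox); rewrite /g dotZr ltr_pdivrMl// mulr1 => h.
by rewrite pmulr_rle0// subr_le0 ltW.
Qed.

End Polar.

(** * Supporting hyperplanes and boundary points of the domain *)

Section Support.
Variables (R : realType) (d : nat) (Omega : set 'rV[R]_d) (K : set 'rV[R]_(d + 1)).
Hypotheses (Omega_open : open Omega) (Omega_bounded : bounded_set Omega).
Hypothesis Omega0 : Omega 0.
Hypothesis K_domain : convex_domain K.
Hypothesis K_cone : [set X + v | X in K & v in cone_over Omega] = K.
Hypothesis K_directions :
  proj_points (dual_cone (cone_over Omega)) `<=` supporting_directions K.
Local Notation Os := (polar Omega).
Local Notation s := (support_function K).
Local Notation ds := (subdifferential Os s).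

Lemma cone_shift X x t : K X -> Omega x -> 0 < t -> K (X + t *: pt x 1).
Proof.
move=> KX Ox t0; rewrite -K_cone; exists X => //; exists (t *: pt x 1) => //.
by exists t, x.
Qed.

Lemma interior_domain : interior K = K.
Proof. by have [_ oK _] := K_domain; exact: (interior_id _).1. Qed.

(** A supporting hyperplane only avoids [K]; the cone decides the side. Moving upwards along
    [(0, 1)] stays in [K] and lowers the value of [(y, -1)] at unit speed, so from a value at least
    [c] it would meet the hyperplane. *)
Lemma supporting_hyperplane_lt y c X : Os y ->
  supporting_hyperplane K (pt y (- 1)) c -> K X -> dot X (pt y (- 1)) < c.
Proof.
move=> Oy [_ disj _] KX; rewrite ltNge; apply/negP => cX.
suff [t [t0 ht]] : exists t, 0 <= t /\ dot (X + t *: pt 0 1) (pt y (- 1)) = c.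
  have Kt : K (X + t *: pt 0 1).
    have [->|tn0] := eqVneq t 0; first by rewrite scale0r addr0.
    by apply: cone_shift => //; rewrite lt_def tn0.
  suff : (hyperplane (pt y (- 1)) c `&` K) (X + t *: pt 0 1) by rewrite disj.
  by split => //; rewrite /hyperplane/= dotC.
exists (dot X (pt y (- 1)) - c); split; first by rewrite subr_ge0.
by rewrite dotDl dotZl dot_pt dot0l; ring.
Qed.

Lemma domain_neq0 : K !=set0. Proof. by have [] := K_domain. Qed.

(** Any supporting hyperplane of this direction bounds the supremum in [s y], which is therefore a
    true supremum and not the default value of [sup]. *)
Lemma supporting_hyperplaneE y c : Os y ->
  supporting_hyperplane K (pt y (- 1)) c -> c = s y.
Proof.
move=> Oy hc; have ltc X := supporting_hyperplane_lt (X := X) Oy hc.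
have [X0 KX0] := domain_neq0.
have hs : has_sup [set dot X (pt y (- 1)) | X in K].
  split; first by exists (dot X0 (pt y (- 1))), X0.
  by exists c => _ [X KX <-]; exact/ltW/ltc.
apply/eqP; rewrite eq_le; apply/andP; split; last first.
  by apply: ge_sup; [exact: hs.1|move=> _ [X KX <-]; exact/ltW/ltc].
rewrite leNgt; apply/negP => sc.
have [_ _ [P [Pc [clP _]]]] := hc.
have nP : nbhs P ((fun X => dot X (pt y (- 1))) @^-1` [set r | s y < r]).
  apply: dot_continuous; apply: open_nbhs_nbhs; split; first exact: open_gt.
  by rewrite /= dotC Pc.
have [X [KX /=]] := clP _ nP.
rewrite ltNge => /negP; apply; apply: ub_le_sup; first exact: hs.2.
by exists X.
Qed.

Lemma supporting_hyperplane_support y : Os y ->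
  supporting_hyperplane K (pt y (- 1)) (s y).
Proof.
move=> Oy.
have [c hc] := K_directions (polar_dual Omega_bounded Omega0 Oy).
by rewrite -(supporting_hyperplaneE Oy hc).
Qed.

Lemma lt_support y X : Os y -> K X -> dot X (pt y (- 1)) < s y.
Proof.
by move=> Oy; apply: supporting_hyperplane_lt => //; exact: supporting_hyperplane_support.
Qed.

Lemma support_le y c : Os y -> (forall X, K X -> dot X (pt y (- 1)) <= c) -> s y <= c.
Proof.
move=> Oy Kc; apply: ge_sup; last by move=> _ [X KX <-]; exact: Kc.
by have [X KX] := domain_neq0; exists (dot X (pt y (- 1))), X.
Qed.

Lemma closure_le_support y X : Os y -> closure K X -> dot X (pt y (- 1)) <= s y.
Proof.
move=> Oy clX; rewrite leNgt; apply/negP => sX.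
have nX : nbhs X ((fun X => dot X (pt y (- 1))) @^-1` [set r | s y < r]).
  apply: dot_continuous; apply: open_nbhs_nbhs; split => //; exact: open_gt.
have [Y [KY /=]] := clX _ nX.
by rewrite ltNge => /negP; apply; exact/ltW/lt_support.
Qed.

Lemma boundary_subdifferential y P : Os y -> boundary K P ->
  dot P (pt y (- 1)) = s y ->
  ds y (lsubmx P) /\ P = pt (lsubmx P) (dot (lsubmx P) y - s y).
Proof.
move=> Oy [clP _] Ps.
have hP : height P = dot (lsubmx P) y - s y.
  by have := Ps; rewrite -{1}(pt_eta P) dot_pt => <-; ring.
split; last by rewrite -hP pt_eta.
move=> z Oz; have := closure_le_support Oz clP.
by rewrite -{1}(pt_eta P) dot_pt hP dotBr; lra.
Qed.

Lemma subdifferential_neq0 y : Os y -> ds y !=set0.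
Proof.
move=> Oy; have [_ _ [P [Ps bP]]] := supporting_hyperplane_support Oy.
exists (lsubmx P); have [] // := boundary_subdifferential Oy bP.
by rewrite dotC.
Qed.

(* A hyperplane separating the point from [K] has a direction in the closure of
   [polar Omega], since [K] is stable under the cone; it is then moved to
   the interior along the segment to [0]. *)
Lemma subdifferential_boundary y p : Os y -> ds y p ->
  boundary K (pt p (dot p y - s y)).
Proof.
move=> Oy dp; set P := pt _ _.
have Py : dot P (pt y (- 1)) = s y by rewrite dot_pt; ring.
have Pz z : Os z -> dot P (pt z (- 1)) <= s z.
  by move=> Oz; rewrite dot_pt; have := dp z Oz; rewrite dotBr; lra.
split; last first.
  by rewrite interior_domain => KP; have := lt_support Oy KP; rewrite Py ltxx.
have [K0 oK cK] := K_domain.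
apply: contrapT => nP.
have [phi [c [phic cP]]] := separate_point (convex_set_comb cK) K0 nP.
have [X0 KX0] := K0.
pose y0 := lsubmx phi; pose tau := - height phi.
have phiE : phi = pt y0 (- tau) by rewrite opprK pt_eta.
(* [phi] is bounded above on [K], so it cannot be positive on the direction [(x, 1)] of the cone. *)
have recede x : Omega x -> dot x y0 <= tau.
  move=> Ox; rewrite leNgt; apply/negP => xy.
  pose a := dot x y0 - tau; have a0 : 0 < a by rewrite subr_gt0.
  pose t := (`|c - dot X0 phi| + 1) / a.
  have t0 : 0 < t by rewrite divr_gt0// ltr_wpDl.
  have := phic _ (cone_shift KX0 Ox t0).
  rewrite dotDl dotZl phiE dot_pt mul1r -/a -phiE divfK ?gt_eqF//.
  by have := ler_norm (c - dot X0 phi); lra.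
have tau_ge0 : 0 <= tau by have := recede 0 Omega0; rewrite dot0l.
(* If [tau] were 0, [y0] would pair nonpositively with a small positive multiple of itself in
   [Omega]; then [phi] would vanish and separate nothing. *)
have tau_gt0 : 0 < tau.
  rewrite lt_def tau_ge0 andbT; apply/eqP => tau0.
  suff y00 : y0 = 0.
    move: cP; rewrite phiE y00 tau0 dotC; apply/negP; rewrite -leNgt.
    have := phic _ KX0; rewrite phiE y00 tau0 oppr0.
    have -> : pt 0 0 = 0 :> 'rV[R]_(d + 1).
      by rewrite /pt (_ : const_mx 0 = 0) ?row_mx0//; apply/matrixP => i j; rewrite !mxE.
    by rewrite dot0l dot0r.
  have /nbhs_ballP[e /= e0 eO] := open_nbhs_nbhs (conj Omega_open Omega0).
  pose t := e / 2 / (`|y0| + 1).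
  have t0 : 0 < t by rewrite !divr_gt0// ltr_wpDl.
  have Oty : Omega (t *: y0).
    apply: eO; rewrite -ball_normE /= sub0r normrN normrZ gtr0_norm//.
    apply: (@le_lt_trans _ _ (e / 2)); last by rewrite ltr_pdivrMr// mulrDr mulr1 ltrDl.
    by rewrite /t mulrAC ler_pdivrMr ?ltr_wpDl// ler_pM2l ?divr_gt0// lerDl.
  have := recede _ Oty; rewrite dotZl tau0 pmulr_rle0// => yy.
  apply/eqP; rewrite -normr_eq0 -sqrf_eq0 eq_le sqr_ge0 andbT.
  exact: le_trans (dot_sqr_ge _) yy.
pose y1 := tau^-1 *: y0; pose c1 := tau^-1 * c.
have phi1 X : dot X (pt y1 (- 1)) = tau^-1 * dot X phi.
  rewrite -(pt_eta X) phiE !dot_pt dotZr; field.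
  by rewrite gt_eqF.
have recede1 x : Omega x -> dot x y1 <= 1.
  by move=> /recede h; rewrite dotZr ler_pdivrMl// mulr1.
have P1 : c1 < dot P (pt y1 (- 1)) by rewrite phi1 ltr_pM2l// invr_gt0.
have K1 X : K X -> dot X (pt y1 (- 1)) <= c1.
  by move=> KX; rewrite phi1 ler_pM2l ?invr_gt0//; exact: phic.
have O0 : Os 0 by exact: polar0.
have mix X t : dot X (pt ((1 - t) *: y1) (- 1)) =
    (1 - t) * dot X (pt y1 (- 1)) + t * dot X (pt 0 (- 1)).
  by rewrite -(pt_eta X) !dot_pt dotZr dot0r; ring.
(* [P] obeys the support inequality at [(1 - t) *: y1], which lies in the open polar; as [t] tends
   to 0 this contradicts the strict separation [P1]. *)
have main t : 0 < t <= 1 ->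
    (1 - t) * dot P (pt y1 (- 1)) + t * dot P (pt 0 (- 1)) <= (1 - t) * c1 + t * s 0.
  move=> /[dup] t01 /andP[t0 t1]; rewrite -mix.
  have Oyt := polar_contract recede1 t01.
  apply: le_trans (Pz _ Oyt) _; apply: support_le => // X KX; rewrite mix.
  apply: lerD; first by rewrite ler_wpM2l ?subr_ge0// K1.
  by rewrite ler_wpM2l ?ltW// lt_support.
pose a := dot P (pt y1 (- 1)) - c1; have a0 : 0 < a by rewrite subr_gt0.
pose q := `|s 0 - dot P (pt 0 (- 1)) + a|.
pose t := Num.min 1 (a / 2 / (q + 1)).
have q1 : 0 < q + 1 by rewrite ltr_wpDl// normr_ge0.
have t0 : 0 < t by rewrite lt_min ltr01 !divr_gt0.
have tq : t * (q + 1) <= a / 2.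
  by rewrite -ler_pdivlMr// ge_min lexx orbT.
have := main t; rewrite t0 ge_min lexx => /(_ isT).
have : t * (s 0 - dot P (pt 0 (- 1)) + a) <= t * q by rewrite ler_pM2l// ler_norm.
by rewrite /a in a0 tq *; lra.
Qed.

(** With this form the volume estimates see [K] only through [s] and its subdifferential. *)
Lemma normal_nbhdE (omega : 'rV[R]_d -> R) eps (b : set 'rV[R]_d) Z : b `<=` Os ->
  normal_nbhd omega K eps b Z <-> exists y p t, [/\ b y, 0 < t < eps, ds y p &
    let q := p + t *: gradient omega y in
    Z = pt q (dot q y - s y - t * omega y)].
Proof.
move=> bO.
have ptE p y t : pt p (dot p y - s y) + t *: normal_map omega y =
    pt (p + t *: gradient omega y)
      (dot (p + t *: gradient omega y) y - s y - t * omega y).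
  rewrite /pt scale_row_mx add_row_mx; congr row_mx.
  by apply/rowP => i; rewrite !mxE dotDl dotZl; ring.
split=> [[y [P [t [yb t_eps bP [c hc Pc] ->]]]]|[y [p [t [yb t_eps dp ->]]]]].
  have Oy := bO _ yb.
  have [|dP PE] := boundary_subdifferential Oy bP.
    by rewrite -(supporting_hyperplaneE Oy hc) dotC.
  by exists y, (lsubmx P), t; split => //=; rewrite -ptE -PE.
have Oy := bO _ yb.
exists y, (pt p (dot p y - s y)), t; split => //.
  exact: subdifferential_boundary.
exists (s y); first exact: supporting_hyperplane_support.
by rewrite /hyperplane /= dotC dot_pt; ring.
Qed.

End Support.

(** * Subdifferentials and conjugate functions *)

Section Conjugate.
Variables (R : realType) (d : nat) (O : set 'rV[R]_d) (M : R).
Hypothesis O_bounded : forall y, O y -> `|y| <= M.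
Hypothesis O_neq0 : O !=set0.

(** The Legendre transform of [f] restricted to [O], used for [s] and for [s + t * omega]. With [O]
    bounded and [f] bounded below on it, it is finite and Lipschitz on the whole space. *)
Definition conjugate (f : 'rV[R]_d -> R) (q : 'rV[R]_d) : R :=
  sup [set dot q y - f y | y in O].

Variables (f : 'rV[R]_d -> R) (m : R).
Hypothesis f_ge : forall y, O y -> m <= f y.

Lemma radius_ge0 : 0 <= M.
Proof. by have [y Oy] := O_neq0; exact: le_trans (normr_ge0 y) (O_bounded Oy). Qed.

Lemma dot_le_radius q y : O y -> dot q y <= d%:R * M * `|q|.
Proof.
move=> Oy; rewrite (le_trans (ler_norm _))// (le_trans (dot_norm_le _ _))//.
by rewrite -mulrA ler_wpM2l// mulrC ler_wpM2r// O_bounded.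
Qed.

Lemma conjugate_ge q y : O y -> dot q y - f y <= conjugate f q.
Proof.
move=> Oy; apply: ub_le_sup; last by exists y.
exists (d%:R * M * `|q| - m) => _ [z Oz <-].
by apply: lerB; [exact: dot_le_radius|exact: f_ge].
Qed.

Lemma conjugate_le q c : (forall y, O y -> dot q y - f y <= c) -> conjugate f q <= c.
Proof.
move=> qc; apply: ge_sup; last by move=> _ [y Oy <-]; exact: qc.
by have [y Oy] := O_neq0; exists (dot q y - f y), y.
Qed.

Lemma conjugate_lipschitz q q' :
  `|conjugate f q - conjugate f q'| <= d%:R * M * `|q - q'|.
Proof.
have le x x' : conjugate f x <= conjugate f x' + d%:R * M * `|x - x'|.
  apply: conjugate_le => y Oy; have := conjugate_ge x' Oy.
  by have := dot_le_radius (x - x') Oy; rewrite dotBl; lra.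
by rewrite ler_norml; have := le q q'; have := le q' q; rewrite (distrC q'); lra.
Qed.

Lemma conjugate_continuous : continuous (conjugate f).
Proof. exact: (lipschitz_continuous_fun conjugate_lipschitz). Qed.

Lemma subdifferential_conjugate y q : O y ->
  subdifferential O f y q <-> conjugate f q = dot q y - f y.
Proof.
move=> Oy; split=> [dq|qy z Oz].
  apply/eqP; rewrite eq_le conjugate_ge// andbT; apply: conjugate_le => z Oz.
  by have := dq z Oz; rewrite dotBr; lra.
by have := conjugate_ge q Oz; rewrite qy dotBr; lra.
Qed.

End Conjugate.

Section Subdifferential.
Variables (R : realType) (d : nat) (O : set 'rV[R]_d) (M m : R) (s : 'rV[R]_d -> R).
Hypothesis O_open : open O.
Hypothesis O_bounded : forall y, O y -> `|y| <= M.
Hypothesis O_neq0 : O !=set0.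
Hypothesis O_comb : forall x y t, O x -> O y -> 0 <= t <= 1 ->
  O ((1 - t) *: x + t *: y).
Hypothesis s_ge : forall y, O y -> m <= s y.
Hypothesis ds_neq0 : forall y, O y -> subdifferential O s y !=set0.
Local Notation ds := (subdifferential O s).
Local Notation "s ^*" := (conjugate O s) : ring_scope.

(** Convexity of [s] comes from a subgradient at the intermediate point, tested at both ends. *)
Lemma subdifferential_convex x y t : O x -> O y -> 0 <= t <= 1 ->
  s ((1 - t) *: x + t *: y) <= (1 - t) * s x + t * s y.
Proof.
move=> Ox Oy t01; have Oz := O_comb Ox Oy t01.
have /andP[t0 t1] := t01.
have [p dp] := ds_neq0 Oz; set z := _ + _ in Oz dp *.
have hx := dp x Ox; have hy := dp y Oy.
have : (1 - t) * dot p (x - z) + t * dot p (y - z) = 0.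
  rewrite -!dotZr -dotDr (_ : _ + _ = 0) ?dot0r//.
  rewrite !scalerBr addrACA -/z -opprD -scalerDl.
  by rewrite (_ : 1 - t + t = 1) ?scale1r ?subrr//; ring.
have : (1 - t) * (s z + dot p (x - z)) <= (1 - t) * s x.
  by rewrite ler_wpM2l// subr_ge0.
have : t * (s z + dot p (y - z)) <= t * s y by rewrite ler_wpM2l.
by move=> ? ? ?; lra.
Qed.

Definition subdifferential_image (k : set 'rV[R]_d) : set 'rV[R]_d :=
  \bigcup_(y in k) ds y.

(** The maximum norm of [p] is attained at some coordinate, so testing the subgradient inequality at
    the finitely many points [y + r e_i] and [y - r e_i] bounds it. A single [e] is both radius and
    inverse bound, as [compact_uniform_radius] expects. *)
Lemma subdifferential_locally_bounded y : O y -> exists2 e, 0 < e &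
  forall z p, `|y - z| < e -> O z -> ds z p -> `|p| <= e^-1.
Proof.
move=> Oy; have /nbhs_ballP[e /= e0 eO] := open_nbhs_nbhs (conj O_open Oy).
pose r := e / 2; have r0 : 0 < r by rewrite divr_gt0.
pose u (a : R) i : 'rV[R]_d := y + a *: delta_mx 0 i.
have Ou a i : `|a| = r -> O (u a i).
  move=> ar; apply: eO; rewrite -ball_normE /= opprD addrA subrr sub0r normrN.
  rewrite normrZ ar norm_delta_mx mulr1.
  by rewrite /r ltr_pdivrMr// mulrDr mulr1 ltrDl.
pose B := \sum_i (`|s (u r i)| + `|s (u (- r) i)|) + `|m|.
have B0 : 0 <= B by rewrite addr_ge0// sumr_ge0.
have sB a i : `|a| = r -> (a = r \/ a = - r) -> s (u a i) - m <= B.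
  move=> ar a2; apply: lerD; last by rewrite -normrN ler_norm.
  rewrite (bigD1 i)//= (le_trans (ler_norm _))//.
  have : 0 <= \sum_(j < d | j != i) (`|s (u r j)| + `|s (u (- r) j)|).
    by apply: sumr_ge0 => j _; rewrite addr_ge0.
  move=> h; case: a2 => ->.
    by rewrite -addrA lerDl addr_ge0.
  by rewrite addrAC addrC lerDl addr_ge0.
pose e' := Num.min (r / (2 * (d%:R + 1))) (r / (2 * (B + 1))).
have d1 : 0 < 2 * (d%:R + 1) :> R by rewrite mulr_gt0// ltr_wpDl.
have B1 : 0 < 2 * (B + 1) by rewrite mulr_gt0// ltr_wpDl.
have e'0 : 0 < e' by rewrite lt_min !divr_gt0.
exists e' => // z p yz Oz dp.
apply: (@le_trans _ _ (2 * (B + 1) / r)); last first.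
  by rewrite -[leLHS]invrK lef_pV2 ?posrE ?invr_gt0 ?divr_gt0// invf_div ge_min lexx orbT.
have [->|p0] := eqVneq `|p| 0; first by rewrite divr_ge0// ltW.
have [[i0 i] pi] := mx_norm_neq0 p0.
have {}pi : `|p| = `|p 0 i| by rewrite -(ord1 i0).
pose a := if 0 <= p 0 i then r else - r.
have a2 : a = r \/ a = - r by rewrite /a; case: ifP; [left|right].
have ar : `|a| = r by case: a2 => ->; rewrite ?normrN gtr0_norm.
have ap : dot p (a *: delta_mx 0 i) = r * `|p|.
  rewrite dotZr dot_delta pi /a; case: ifPn => [h|]; first by rewrite ger0_norm.
  by rewrite -ltNge => h; rewrite ltr0_norm// mulrN mulNr.
have := dp _ (Ou a i ar).
rewrite (_ : u a i - z = (y - z) + a *: delta_mx 0 i); last by rewrite /u addrAC.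
rewrite dotDr ap => h1.
have h2 := sB a i ar a2.
have h3 : `|dot p (y - z)| <= r / 2 * `|p|.
  apply: le_trans (dot_norm_le _ _) _; rewrite mulrCA mulrC ler_wpM2r//.
  have : `|y - z| * (2 * (d%:R + 1)) <= r.
    by rewrite -ler_pdivlMr// (le_trans (ltW yz))// ge_min lexx.
  have : 0 <= `|y - z| by [].
  by move=> ? ?; lra.
have h4 := s_ge Oz.
move: h3; rewrite ler_norml => /andP[h3 _].
rewrite ler_pdivlMr//; lra.
Qed.

Lemma subdifferential_image_bounded k : compact k -> k `<=` O ->
  exists B, forall y p, k y -> ds y p -> `|p| <= B.
Proof.
move=> ck kO.
have [|e e0 eB] := @compact_uniform_radius R d k
    (fun y r => forall p, O y -> ds y p -> `|p| <= r^-1) ck.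
  move=> y ky; have [e e0 eB] := subdifferential_locally_bounded (kO _ ky).
  exists e => // z r yz /andP[r0 re] p Oz dp.
  by rewrite (le_trans (eB _ _ yz Oz dp))// lef_pV2 ?posrE// ltW.
exists ((e / 2)^-1) => y p ky dp; apply: (eB y (e / 2)) => //; last exact: kO.
by rewrite divr_gt0//= ltr_pdivrMr// mulrDr mulr1 ltrDl.
Qed.

Lemma support_continuous_at y : O y -> {for y, continuous s}.
Proof.
move=> Oy A /nbhs_ballP[c /= c0 cA].
have /nbhs_ballP[e /= e0 eO] := open_nbhs_nbhs (conj O_open Oy).
have [e1 e10 eB] := subdifferential_locally_bounded Oy.
pose L := d%:R * e1^-1 + 1.
have L0 : 0 < L by rewrite ltr_wpDl// mulr_ge0// invr_ge0 ltW.
apply/nbhs_ballP; exists (Num.min (Num.min e e1) (c / L)) => /=.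
  by rewrite !lt_min e0 e10 divr_gt0.
move=> z yz; apply: cA.
move: yz; rewrite -!ball_normE /= !lt_min => /andP[/andP[yze yze1]].
rewrite ltr_pdivlMr// => yzc.
have Oz : O z by apply: eO; rewrite -ball_normE.
apply: le_lt_trans yzc.
have le x x' : O x -> O x' -> `|y - x| < e1 -> s x - s x' <= `|x - x'| * L.
  move=> Ox Ox' yx; have [p dp] := ds_neq0 Ox.
  have h := dp _ Ox'.
  have : `|dot p (x' - x)| <= `|x - x'| * L.
    apply: le_trans (dot_norm_le _ _) _; rewrite mulrA mulrC (distrC x') ler_wpM2l//.
    apply: (@le_trans _ _ (d%:R * e1^-1)); last by rewrite lerDl.
    by rewrite ler_wpM2l//; exact: eB dp.
  by rewrite ler_norml => /andP[? _]; lra.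
have h1 := le _ _ Oy Oz; rewrite subrr normr0 in h1.
have h2 := le _ _ Oz Oy yze1; rewrite distrC in h2.
by rewrite ler_norml h1// andbT; lra.
Qed.

(** [p] is a subgradient at [y] exactly when [s^* p - (dot p y - s y)] vanishes. This quantity is
    continuous in both variables, so not being a subgradient is an open condition, uniform for [y]
    in the compact [k]. *)
Lemma subdifferential_image_compact k : compact k -> k `<=` O ->
  compact (subdifferential_image k).
Proof.
move=> ck kO; have [B kB] := subdifferential_image_bounded ck kO.
apply: bounded_closed_compact.
  exists B; split; first exact: num_real.
  by move=> b Bb p [y ky dp] /=; exact: le_trans (kB _ _ ky dp) (ltW Bb).
rewrite -openC openE => p np.
have [|e e0 eP] := @compact_uniform_radius R d k
  (fun y r => forall p', `|p - p'| < r -> O y -> ~ ds y p') ck.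
  move=> y ky; have Oy := kO _ ky.
  pose c := s^* p - (dot p y - s y).
  have c0 : 0 < c.
    rewrite subr_gt0 lt_def (conjugate_ge O_bounded s_ge)// andbT.
    apply/eqP => h; apply: np; exists y => //.
    by apply/(subdifferential_conjugate O_bounded O_neq0 s_ge).
  have /nbhs_ballP[e1 /= e10 e1c] : nbhs y (s @^-1` ball (s y) (c / 4)).
    by apply: support_continuous_at => //; apply: nbhsx_ballx; rewrite divr_gt0.
  have M0 := radius_ge0 O_bounded O_neq0.
  pose L1 := d%:R * `|p| + 1; pose L2 := 2 * (d%:R * M) + 1.
  have L10 : 0 < L1 by rewrite ltr_wpDl// mulr_ge0.
  have L20 : 0 < L2 by rewrite ltr_wpDl// !mulr_ge0.
  exists (Num.min e1 (Num.min (c / 4 / L1) (c / 4 / L2))).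
    by rewrite !lt_min e10 !divr_gt0.
  move=> y' r; rewrite !lt_min => /and3P[ye1 yc _] /and4P[r0 _ _ rc] p' pr Oy' dp'.
  have := e1c y'; rewrite -!ball_normE /= => /(_ ye1) sy.
  rewrite ltr_pdivlMr// in yc.
  have pc : `|p - p'| * L2 < c / 4 by rewrite -ltr_pdivlMr//; exact: lt_trans pr rc.
  have := conjugate_lipschitz O_bounded O_neq0 s_ge p p'.
  move/(subdifferential_conjugate O_bounded O_neq0 s_ge _ Oy') : dp' => ->.
  have h1 := dot_le_radius O_bounded (p' - p) Oy'.
  rewrite dotBl distrC in h1.
  have h2 : dot p (y' - y) <= `|y - y'| * L1.
    rewrite (le_trans (ler_norm _))// (le_trans (dot_norm_le _ _))//.
    by rewrite mulrA mulrC distrC ler_wpM2l// lerDl.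
  rewrite dotBr in h2.
  have h3 := normr_ge0 (p - p').
  move: sy; rewrite ltr_norml ler_norml => /andP[_ sy] /andP[_ hp].
  by rewrite /c /L2 in c0 sy yc pc *; lra.
apply/nbhs_ballP; exists (e / 2); first by rewrite /= divr_gt0.
move=> p'; rewrite -ball_normE /= => pp' [y ky dp'].
apply: (eP y (e / 2) ky _ p' pp' (kO _ ky) dp').
by rewrite divr_gt0//= ltr_pdivrMr// mulrDr mulr1 ltrDl.
Qed.


End Subdifferential.

(** * Points with several maximisers form a null set *)

Section NonUnique.
Variables (R : realType) (n : nat).

Lemma lebesgue_countable_null (T : countType) (F : T -> set 'rV[R]_n.+1) :
  (forall i, lebesgue (F i) = 0%E) -> lebesgue (\bigcup_i F i) = 0%E.
Proof.
move=> F0; pose G k : set 'rV[R]_n.+1 := if unpickle k is Some i then F i else set0.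
apply/eqP; rewrite eq_le lebesgue_ge0 andbT.
apply: (@le_trans _ _ (lebesgue (\bigcup_k G k))).
  by apply: le_lebesgue => x [i _ Fx]; exists (pickle i) => //; rewrite /G pickleK.
apply: le_trans (lebesgue_sigma_subadditive _) _.
rewrite eseries0// => k _ _; rewrite /G.
by case: (unpickle k) => [i|]; [exact: F0|exact: lebesgue_set0].
Qed.

(** For convex [g]: along axis [i] the left derivative is at most [r] and the right one at least
    [r']. Inequalities for all [t] make the set closed when [g] is continuous. *)
Definition kink (g : 'rV[R]_n.+1 -> R) i (r r' : R) : set 'rV[R]_n.+1 :=
  [set q | forall t, 0 < t -> g q + r' * t <= g (q + t *: delta_mx 0 i) /\
                              g q - r * t <= g (q - t *: delta_mx 0 i)].

Lemma kink_closed g i r r' : continuous g -> closed (kink g i r r').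
Proof.
move=> cg.
have cgt (v : 'rV[R]_n.+1) : continuous (fun q : 'rV[R]_n.+1 => g (q + v)).
  move=> q; apply: continuous_comp; last exact: cg.
  by apply: continuousD; [exact: cvg_id|exact: cst_continuous].
have cle (v : 'rV[R]_n.+1) c : closed [set q : 'rV[R]_n.+1 | g q + c <= g (q + v)].
  rewrite (_ : mkset _ = (fun q : 'rV[R]_n.+1 => g (q + v) - g q) @^-1` [set x | c <= x]).
    apply: preimage_closed; last exact: closed_ge.
    by move=> q _; apply: continuousB; [exact: cgt|exact: cg].
  by apply/seteqP; split => q /=; rewrite lerBrDl.
have -> : kink g i r r' = \bigcap_(t in [set t | 0 < t])
    ([set q : 'rV[R]_n.+1 | g q + r' * t <= g (q + t *: delta_mx 0 i)] `&`
     [set q : 'rV[R]_n.+1 | g q + - (r * t) <= g (q + - (t *: delta_mx 0 i))]).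
  by apply/seteqP; split => q h t /h.
by apply: closed_bigI => t _; exact: closedI.
Qed.

(* Translates of a set of kinks along the direction of the kink are disjoint. *)
Lemma kink_null g i r r' : continuous g -> r < r' -> lebesgue (kink g i r r') = 0%E.
Proof.
move=> cg rr'.
pose c (N : nat) : 'rV[R]_n.+1 := const_mx N%:R.
pose T N := kink g i r r' `&` box (- c N) (c N).
have -> : kink g i r r' = \bigcup_N T N.
  apply/seteqP; split => [q qk|q [N _ []//]].
  exists (Num.truncn `|q|).+1 => //; split=> // j; rewrite !mxE.
  have := le_lt_trans (coord_le_norm q j) (truncnS_gt `|q|).
  by rewrite ltr_norml => /andP[-> /ltW ->].
apply: lebesgue_countable_null => N.
have mT : measurable (T N : set (borelType R n.+1)).
  by apply: measurableI; [apply: closed_borel; exact: kink_closed|exact: box_borel].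
(* The shifts [1/(j+1)] are infinitely many, distinct and at most 1, so all translates fit into one
   box of volume [V]. *)
pose v (j : nat) : 'rV[R]_n.+1 := j.+1%:R^-1 *: delta_mx 0 i.
pose V := box_vol (- c N) (c N.+1).
have bound (J : nat) : (J%:R%:E * lebesgue (T N) <= V%:E)%E.
  apply: le_trans (lebesgue_box _ _).
  apply: (@disjoint_translates R n (T N) v _ J) => //.
    have disj k l : (k < l)%N -> ~ (translate (v k) (T N) `&` translate (v l) (T N) !=set0).
      move=> kl [x [[q [qk _] qx] [q' [q'k _] q'x]]].
      pose t := k.+1%:R^-1 - l.+1%:R^-1 : R.
      have t0 : 0 < t by rewrite subr_gt0 ltf_pV2 ?posrE// ltr_nat.
      have qq' : q' = q + t *: delta_mx 0 i.
        by rewrite scalerBl -/(v k) -/(v l) addrA qx -q'x addrK.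
      (* The increment of [g] from [q] to [q'] is at least [r' * t] because [q] is a kink and at
         most [r * t] because [q'] is one. *)
      have [h1 _] := qk _ t0; rewrite -qq' in h1.
      have [_ h2] := q'k _ t0; rewrite qq' addrK -qq' in h2.
      have : r * t < r' * t by rewrite ltr_pM2r.
      by lra.
    move=> k l _ _ kl; apply/eqP/negPn/negP => /eqP /eqP.
    case: ltngtP kl => // kl kl'.
    - by move=> _; exact: (disj _ _ kl).
    - by move=> _; apply: (disj _ _ kl); rewrite setIC.
  move=> j _ x [q [_ qb] <-] l; have /andP[h1 h2] := qb l; rewrite !mxE in h1 h2 *.
  have i0 : 0 < j.+1%:R^-1 :> R by rewrite invr_gt0.
  have i1 : j.+1%:R^-1 <= 1 :> R by rewrite invf_le1// ler1n.
  have jb (c0 : bool) : (0 : R) <= (j.+1%:R^-1 * c0%:R : R) <= (1 : R).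
    by case: c0 => /=; rewrite ?mulr1 ?mulr0 ?(ltW i0) ?lexx ?ler01//; exact: i1.
  have := jb ((0 == 0 :> 'I_1) && (l == i)).
  move=> /andP[v0 v1]; apply/andP; split; first by rewrite (lt_le_trans h1)// lerDl.
  by apply: le_trans (lerD h2 v1) _; rewrite natr1.
have Tfin : lebesgue (T N) \is a fin_num.
  rewrite ge0_fin_numE ?lebesgue_ge0//.
  by have := bound 1%N; rewrite mul1e => /le_lt_trans; apply; rewrite ltry.
rewrite -(fineK Tfin); congr EFin; apply/eqP; rewrite eq_le.
rewrite fine_ge0 ?lebesgue_ge0// andbT leNgt; apply/negP => d0.
have {}bound (J : nat) : J%:R * fine (lebesgue (T N)) <= V.
  by rewrite -lee_fin EFinM fineK.
have := bound (Num.truncn (V / fine (lebesgue (T N)))).+1.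
by rewrite leNgt => /negP; apply; rewrite -ltr_pdivrMr//; exact: truncnS_gt.
Qed.

Variables (O : set 'rV[R]_n.+1) (M m : R) (s : 'rV[R]_n.+1 -> R).
Hypothesis O_bounded : forall y, O y -> `|y| <= M.
Hypothesis O_neq0 : O !=set0.
Hypothesis s_ge : forall y, O y -> m <= s y.

Definition multiply_supported : set 'rV[R]_n.+1 :=
  [set q | exists y y', [/\ O y, O y', y != y', subdifferential O s y q &
                          subdifferential O s y' q]].

(** Two maximisers are two subgradients of the conjugate at [q]. They differ in some coordinate, and
    two rationals between its values put [q] in one of countably many sets of kinks. *)
Lemma multiply_supported_null : lebesgue multiply_supported = 0%E.
Proof.
pose F (z : 'I_n.+1 * (rat * rat)) :=
  if (z.2.1 < z.2.2) then kink (conjugate O s) z.1 (ratr z.2.1) (ratr z.2.2) else set0.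
apply/eqP; rewrite eq_le lebesgue_ge0 andbT.
apply: (@le_trans _ _ (lebesgue (\bigcup_z F z))); last first.
  rewrite lebesgue_countable_null// => z; rewrite /F.
  case: ifPn => [zz|_]; last exact: lebesgue_set0.
  apply: kink_null; last by rewrite ltr_rat.
  exact: (conjugate_continuous O_bounded O_neq0 s_ge).
apply: le_lebesgue => q [y [y' [Oy Oy' yy' dy dy']]].
have {yy'} [i yi] : exists i, y 0 i != y' 0 i.
  apply/existsP; rewrite -negb_forall; apply: contra yy' => /forallP h.
  by apply/eqP/rowP => i; exact/eqP/h.
wlog lt_yi : y y' Oy Oy' dy dy' yi / y 0 i < y' 0 i.
  move=> wl; have := yi; rewrite neq_lt => /orP[|h]; first exact: wl yi.
  by apply: (wl y' y) => //; rewrite eq_sym.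
have [a] := @rat_in_itvoo R _ _ lt_yi; rewrite in_itv/= => /andP[ya ay'].
have [b] := @rat_in_itvoo R _ _ ay'; rewrite in_itv/= => /andP[ab by'].
exists (i, (a, b)) => //; rewrite /F/= -(ltr_rat R) ab => t t0.
have cy := (subdifferential_conjugate O_bounded O_neq0 s_ge q Oy).1 dy.
have cy' := (subdifferential_conjugate O_bounded O_neq0 s_ge q Oy').1 dy'.
split.
  rewrite cy'; apply: le_trans (conjugate_ge O_bounded s_ge _ Oy').
  rewrite dotDl dotZl (dotC (delta_mx _ _)) dot_delta.
  have : ratr b * t <= t * y' 0 i by rewrite mulrC ler_pM2l// ltW.
  by move=> ?; lra.
rewrite cy; apply: le_trans (conjugate_ge O_bounded s_ge _ Oy).
rewrite dotBl dotZl (dotC (delta_mx _ _)) dot_delta.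
have : t * y 0 i <= ratr a * t by rewrite mulrC ler_pM2r// ltW.
by move=> ?; lra.
Qed.

End NonUnique.

(** * Gradients and subgradients *)

Section Gradient.
Variables (R : realType) (d : nat).
Implicit Types (f g : 'rV[R]_d -> R) (O : set 'rV[R]_d).

Lemma derive_gradient f y v : differentiable f y -> 'D_v f y = dot (gradient f y) v.
Proof.
move=> df; rewrite deriveE// {1}(row_sum_delta v) linear_sum dotE.
apply: eq_bigr => i _; rewrite linearZ/= mxE /partial deriveE// mulrC.
by [].
Qed.

(** One step [h] suffices in the two uses below: convexity along the segment carries the estimate
    from [y + h *: v] to its far end. *)
Lemma gradient_approx f y v e : differentiable f y -> 0 < e ->
  exists h, 0 < h <= 1 /\
    `|f (y + h *: v) - f y - h * dot (gradient f y) v| <= h * e.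
Proof.
move=> df e0; rewrite -derive_gradient//.
have /cvg_ex[l lim] := diff_derivable (v := v) df.
have Dl : 'D_v f y = l by exact: cvg_lim lim.
move: lim => /cvgrPdist_le /(_ e e0)[r /= r0 rl].
pose h := Num.min 1 (r / 2).
have h0 : 0 < h by rewrite lt_min ltr01 divr_gt0.
exists h; split; first by rewrite h0 ge_min lexx.
have := rl h; rewrite /= sub0r normrN gtr0_norm// gt_eqF// => /(_ _ isT).
rewrite -Dl (addrC (h *: v)) => hl.
have {hl} : `|'D_v f y - h^-1 *: (f (y + h *: v) - f y)| <= e.
  by apply: hl; rewrite gt_min ltr_pdivrMr// mulrDr mulr1 ltrDl r0 orbT.
move=> hl; rewrite -[X in `|X|](_ : h * (h^-1 * (f (y + h *: v) - f y) - 'D_v f y) = _).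
  by rewrite normrM gtr0_norm// ler_pM2l// distrC.
by rewrite mulrBr mulrA mulfV ?gt_eqF// mul1r.
Qed.

Lemma segment_comb (y z : 'rV[R]_d) h : (1 - h) *: y + h *: z = y + h *: (z - y).
Proof. by rewrite scalerBl scale1r scalerBr -addrA (addrC (- _)). Qed.

Lemma gradient_subdifferential f O y : @convex_function R 'rV[R]_d O f ->
  O y -> differentiable f y -> subdifferential O f y (gradient f y).
Proof.
move=> cf Oy df z Oz; rewrite -subr_ge0; apply/ler_addgt0Pr => e e0.
have [h [h01 he]] := gradient_approx (z - y) df e0.
have /andP[h0 h1] := h01.
have := convex_function_comb cf Oy Oz (t := h); rewrite (ltW h0) h1 => /(_ isT).
rewrite segment_comb => hc; move: he; rewrite ler_norml => /andP[he _].
by rewrite -(@ler_pM2l _ h)//; rewrite mulr0; lra.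
Qed.

(** The half of the sum rule that recovers [p] from [q = p + t grad omega y]: near [y] the term
    [t * g] is linear up to a small error, and convexity of [f] extends the inequality to the whole
    segment. *)
Lemma subdifferential_subr f g O y q t :
  (forall x y t, O x -> O y -> 0 <= t <= 1 -> O ((1 - t) *: x + t *: y)) ->
  (forall x y t, O x -> O y -> 0 <= t <= 1 ->
     f ((1 - t) *: x + t *: y) <= (1 - t) * f x + t * f y) ->
  O y -> 0 < t -> differentiable g y ->
  subdifferential O (fun z => f z + t * g z) y q ->
  subdifferential O f y (q - t *: gradient g y).
Proof.
move=> cO cf Oy t0 dg dq z Oz; rewrite -subr_ge0; apply/ler_addgt0Pr => e e0.
have et : 0 < e / t by rewrite divr_gt0.
have [h [h01 he]] := gradient_approx (z - y) dg et.
have /andP[h0 h1] := h01.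
have hh : 0 <= h <= 1 by rewrite ltW.
have := dq _ (cO _ _ _ Oy Oz hh).
have := cf _ _ _ Oy Oz hh.
rewrite segment_comb (addrC y) addrK dotZr => hc hq.
have {he} : t * `|g (y + h *: (z - y)) - g y - h * dot (gradient g y) (z - y)| <= h * e.
  rewrite (_ : h * e = t * (h * (e / t))); first by rewrite ler_pM2l.
  by field; rewrite gt_eqF.
rewrite (addrC y) -(gtr0_norm t0) -normrM (gtr0_norm t0) ler_norml => /andP[_ he].
by rewrite -(@ler_pM2l _ h)// mulr0 dotBl dotZl; lra.
Qed.

Lemma gradient_bounded f O k : open O -> smooth_on O f -> compact k -> k `<=` O ->
  exists2 L, 0 < L & forall y, k y -> `|gradient f y| <= L.
Proof.
move=> oO sf ck kO.
have [|e e0 eP] := @compact_uniform_radius R d k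
    (fun y r => forall i, `|partial i f y| <= r^-1) ck.
  move=> y ky.
  have near_y : \forall z \near y, forall i, `|partial i f y - partial i f z| < 1.
    apply: (@filter_forall _ _ _ _ (nbhs_filter y)) => i.
    have : {for y, continuous (partial i f)}.
      by apply: differentiable_continuous; exact: (sf [:: i] y (kO _ ky)).
    by move=> /(_ _ (nbhsx_ballx _ _ ltr01)); apply: (@filterS _ _ (nbhs_filter y)).
  have /nbhs_ballP[e /= e0 eP] := near_y.
  pose B := \sum_i `|partial i f y| + 1.
  have B0 : 0 < B by rewrite ltr_wpDl// sumr_ge0.
  exists (Num.min e B^-1); first by rewrite lt_min e0 invr_gt0.
  move=> z r; rewrite !lt_min => /andP[yz _] /and3P[r0 _ rB] i.
  apply: (@le_trans _ _ B); last by rewrite -[leLHS]invrK lef_pV2 ?posrE ?invr_gt0// ltW.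
  have : `|partial i f y - partial i f z| < 1 by apply: eP; rewrite -ball_normE.
  have : `|partial i f z| <= `|partial i f y| + `|partial i f y - partial i f z|.
    by rewrite -(distrC (partial i f z)) (le_trans _ (ler_normD _ _))// addrC subrK.
  have : `|partial i f y| + 1 <= B.
    by rewrite lerD2r (bigD1 i)//= lerDl sumr_ge0.
  by move=> ? ? ?; lra.
exists ((e / 2)^-1); first by rewrite invr_gt0 divr_gt0.
move=> y ky; apply: norm_le_coord => [|i]; first by rewrite invr_ge0 divr_ge0// ltW.
rewrite mxE; apply: eP => //.
by rewrite divr_gt0//= ltr_pdivrMr// mulrDr mulr1 ltrDl.
Qed.

End Gradient.

(** * Volume of the normal neighbourhoods *)

Section NormalSet.
Variables (R : realType) (n : nat) (O : set 'rV[R]_n.+1) (M m : R).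
Variables (s omega : 'rV[R]_n.+1 -> R).
Hypothesis O_open : open O.
Hypothesis O_bounded : forall y, O y -> `|y| <= M.
Hypothesis O_neq0 : O !=set0.
Hypothesis O_comb : forall x y t, O x -> O y -> 0 <= t <= 1 ->
  O ((1 - t) *: x + t *: y).
Hypothesis s_ge : forall y, O y -> m <= s y.
Hypothesis ds_neq0 : forall y, O y -> subdifferential O s y !=set0.
Hypothesis omega_smooth : smooth_on O omega.
Hypothesis omega_convex : @convex_function R 'rV[R]_n.+1 O omega.
Hypothesis omega_lt0 : forall y, O y -> omega y < 0.
Local Notation ds := (subdifferential O s).
Local Notation "s ^*" := (conjugate O s) : ring_scope.

Definition normal_set (eps : R) (b : set 'rV[R]_n.+1) : set 'rV[R]_(n.+1 + 1) :=
  [set Z | exists y p t, [/\ b y, 0 < t < eps, ds y p &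
    let q := p + t *: gradient omega y in
    Z = pt q (dot q y - s y - t * omega y)]].

Lemma omega_differentiable y : O y -> differentiable omega y.
Proof. exact: (@omega_smooth [::]). Qed.

Lemma gradient_omega y z : O y -> O z ->
  omega y + dot (gradient omega y) (z - y) <= omega z.
Proof.
move=> Oy; apply: (gradient_subdifferential omega_convex) => //.
exact: omega_differentiable.
Qed.

(** A convex function lies above its tangent at [y0], which is bounded below on the bounded set
    [O]. *)
Lemma omega_bounded : exists2 W, 0 < W & forall y, O y -> - omega y <= W.
Proof.
have [y0 Oy0] := O_neq0.
have M0 := radius_ge0 O_bounded O_neq0.
pose g := gradient omega y0.
exists (`|omega y0| + n.+1%:R * M * `|g| + n.+1%:R * M * `|g| + 1).
  by rewrite ltr_wpDl// !addr_ge0// !mulr_ge0.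
move=> y Oy; have := gradient_omega Oy0 Oy; rewrite -/g dotBr.
have := dot_le_radius O_bounded g Oy0.
have := dot_le_radius O_bounded (- g) Oy; rewrite dotNl normrN.
by have := ler_norm (- omega y0); rewrite normrN; lra.
Qed.

Lemma normal_set_strip k c L eps : k `<=` O -> 0 < c ->
  (forall y, k y -> - omega y <= c) -> (forall y, k y -> `|gradient omega y| <= L) ->
  normal_set eps k `<=`
    strip (thickening (subdifferential_image O s k) (eps * L)) s^* (c * eps).
Proof.
move=> kO c0 kc kL _ [y [p [t [ky /andP[t0 te] dp ->]]]] /=.
have Oy := kO _ ky.
rewrite /strip /= lsubmx_pt height_pt; split.
  exists p; first by exists y.
  rewrite addrAC subrr add0r normrZ gtr0_norm//.
  by apply: ler_pM; rewrite ?(ltW t0)// ?(ltW te)// kL.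
set q := p + _.
have tc : t * - omega y < c * eps.
  apply: (@le_lt_trans _ _ (t * c)); first by rewrite ler_pM2l// kc.
  by rewrite mulrC ltr_pM2l.
apply/andP; split; last first.
  by have := conjugate_ge O_bounded s_ge q Oy; lra.
apply: conjugate_le => // z Oz.
(* As [p] and [grad omega y] are subgradients at [y], the height dominates [q.z - s z - t omega z];
   since [omega z < 0], it dominates [q.z - s z]. *)
have := dp z Oz.
have : t * (omega y + dot (gradient omega y) (z - y)) <= t * omega z.
  by rewrite ler_pM2l// gradient_omega.
have : t * omega z <= 0 by rewrite pmulr_rle0// ltW// omega_lt0.
by rewrite /q !dotDl !dotZl !dotBr; lra.
Qed.

Lemma normal_set_le k c L eps : k `<=` O -> 0 < c -> 0 < eps ->
  (forall y, k y -> - omega y <= c) -> (forall y, k y -> `|gradient omega y| <= L) ->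
  (lebesgue (normal_set eps k) <=
   (c * eps)%:E * lebesgue (thickening (subdifferential_image O s k) (eps * L)))%E.
Proof.
move=> kO c0 e0 kc kL.
apply: le_trans (le_lebesgue (normal_set_strip (eps := eps) kO c0 kc kL)) _.
apply: (lebesgue_strip_le _ (conjugate_lipschitz O_bounded O_neq0 s_ge)).
exact: mulr_gt0.
Qed.

Lemma dot_sub_continuous_at q y : O y -> {for y, continuous (fun z => dot q z - s z)}.
Proof.
move=> Oy.
have cd : {for y, continuous (dot q)}.
  rewrite (_ : dot q = fun x => dot x q); last by apply/funext => x; rewrite dotC.
  exact: dot_continuous.
have cs : {for y, continuous s}.
  exact: (support_continuous_at O_open s_ge ds_neq0).
exact: (continuousB cd cs).
Qed.

Definition gap_set (k U : set 'rV[R]_n.+1) (g : R) : set 'rV[R]_n.+1 :=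
  [set q | subdifferential_image O s k q /\
     forall z, O z -> ~ U z -> dot q z - s z + g <= s^* q].

Lemma gap_set_closed k U g : compact k -> k `<=` O -> closed (gap_set k U g).
Proof.
move=> ck kO.
have cconj := conjugate_continuous O_bounded O_neq0 s_ge.
have -> : gap_set k U g = subdifferential_image O s k `&`
    \bigcap_(z in [set z | O z /\ ~ U z])
      [set q : 'rV[R]_n.+1 | dot q z - s z + g <= s^* q].
  apply/seteqP; split => [q [? h]|q [? h]]; split => // z.
    by move=> [Oz Uz]; exact: h.
  by move=> Oz Uz; exact: (h z).
apply: closedI.
  apply: compact_closed_rV.
  exact: (subdifferential_image_compact O_open O_bounded O_neq0 s_ge ds_neq0).
apply: closed_bigI => z _.
rewrite (_ : mkset _ = (fun q => s^* q - dot q z) @^-1` [set x | - s z + g <= x]).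
  apply: preimage_closed; last exact: closed_ge.
  by move=> q _; apply: continuousB; [exact: cconj|exact: dot_continuous].
by apply/seteqP; split => q /=; lra.
Qed.

(* By concavity of [z |-> q.z - s z], uniqueness of the maximiser gives a gap
   outside a ball once there is one on its boundary sphere, which is compact. *)
Lemma gap_exists k U q : k `<=` U -> open U -> U `<=` O ->
  subdifferential_image O s k q -> ~ multiply_supported O s q ->
  exists N : nat, gap_set k U N.+1%:R^-1 q.
Proof.
move=> kU oU UO [y ky dy] nq.
have Uy := kU _ ky; have Oy := UO _ Uy.
have sD := subdifferential_conjugate O_bounded O_neq0 s_ge.
have qy := (sD _ _ Oy).1 dy.
have /nbhs_ballP[e /= e0 eU] := open_nbhs_nbhs (conj oU Uy).
pose r := e / 2; have r0 : 0 < r by rewrite divr_gt0.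
pose S : set 'rV[R]_n.+1 := [set w | `|w - y| = r].
have SU : S `<=` U.
  move=> w wr; apply: eU; rewrite -ball_normE /= distrC wr.
  by rewrite /r ltr_pdivrMr// mulrDr mulr1 ltrDl.
have cn : continuous (fun w : 'rV[R]_n.+1 => `|w - y|).
  apply: (@lipschitz_continuous_fun R _ _ 1) => x z; rewrite mul1r.
  by rewrite (le_trans (ler_dist_dist _ _))// opprB addrA subrK.
have cS : compact S.
  have cT : compact (thickening [set y] r).
    by apply: thickening_compact; exact: compact_set1.
  apply: (subclosed_compact _ cT) => [|w wr]; last by exists y => //; rewrite wr.
  rewrite (_ : S = (fun w : 'rV[R]_n.+1 => `|w - y|) @^-1` [set r])//.
  by apply: preimage_closed; [move=> w _; exact: cn|exact: closed_eq].
have S0 : S !=set0.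
  exists (y + r *: delta_mx 0 ord0); rewrite /S /= addrAC subrr add0r normrZ gtr0_norm//.
  by rewrite norm_delta_mx mulr1.
pose f w := s^* q - (dot q w - s w).
have cf : {within S, continuous f}.
  apply: continuous_in_subspaceT => w; rewrite inE => /SU /UO Ow.
  have cw := dot_sub_continuous_at (q := q) Ow.
  have cc : {for w, continuous (fun=> s^* q : R)} by exact: cst_continuous.
  exact: (continuousB cc cw).
have [w0] := @EVT_min_rV _ _ f S S0 cS cf.
rewrite inE => Sw0 w0min; have Ow0 := UO _ (SU _ Sw0).
have g0 : 0 < f w0.
  rewrite lt_def subr_ge0 (conjugate_ge O_bounded s_ge)// andbT.
  apply/eqP => /eqP; rewrite subr_eq0 => /eqP h; apply: nq.
  exists y, w0; split => //; last by apply/(sD _ _ Ow0).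
  apply/eqP => yw0; move: Sw0; rewrite /S /= -yw0 subrr normr0 => r0'.
  by move: r0; rewrite -r0' ltxx.
exists (Num.truncn (f w0)^-1); split; first by exists y.
move=> z Oz Uz.
have rz : r < `|z - y|.
  rewrite ltNge; apply/negP => zr; apply: Uz; apply: eU.
  rewrite -ball_normE /= distrC (le_lt_trans zr)//.
  by rewrite /r ltr_pdivrMr// mulrDr mulr1 ltrDl.
have z0 : 0 < `|z - y| by exact: lt_trans rz.
pose th := r / `|z - y|.
have th0 : 0 < th by rewrite divr_gt0.
have th1 : th < 1 by rewrite ltr_pdivrMr// mul1r.
pose w := (1 - th) *: y + th *: z.
have Sw : S w.
  rewrite /S /= /w segment_comb addrAC subrr add0r normrZ gtr0_norm//.
  by rewrite /th divfK// gt_eqF.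
have th01 : 0 <= th <= 1 by rewrite !ltW.
have h1 := subdifferential_convex O_comb ds_neq0 Oy Oz th01.
have h2 : f w0 <= f w by apply: w0min; rewrite inE.
have fw : f w = s^* q - ((1 - th) * dot q y + th * dot q z - s w).
  by rewrite /f {1}/w dotDr !dotZr.
rewrite -/w in h1; rewrite fw qy in h2.
have h3 : th * f w0 <= f w0 by rewrite ler_piMl// ltW.
have h4 : f w0 <= th * (s^* q - (dot q z - s z)) by rewrite qy; lra.
have h5 : f w0 <= s^* q - (dot q z - s z).
  apply: (le_trans h4); rewrite ler_piMl ?(ltW th1)// subr_ge0.
  exact: (conjugate_ge O_bounded s_ge).
rewrite -lerBrDl; apply: le_trans h5; apply: ltW.
by rewrite invf_plt ?posrE//; exact: truncnS_gt.
Qed.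

(** [H t], the conjugate of [s + t * omega] at [q], runs continuously from [s^* q] at 0 to at least
    [s^* q + a * eps] at [eps], as testing at [y0] shows, so it takes the value [h]. For that [t]
    the gap forces a maximiser into [U], and [subdifferential_subr] turns it into a point of the
    normal set. *)
Lemma normal_set_fibre k U c a W g eps q h : k `<=` U -> U `<=` c -> compact c -> c `<=` O ->
  0 < a -> (forall y, U y -> a <= - omega y) -> 0 < W -> (forall y, O y -> - omega y <= W) ->
  0 < eps -> eps * W < g -> gap_set k U g q ->
  s^* q < h < s^* q + a * eps -> normal_set eps U (pt q h).
Proof.
move=> kU Uc cc cO a0 Ua W0 OW e0 eW [[y0 ky0 dy0] gapq] /andP[h1 h2].
have Oy0 : O y0 by exact/cO/Uc/kU.
have sD := subdifferential_conjugate O_bounded O_neq0 s_ge.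
have qy0 := (sD _ _ Oy0).1 dy0.
pose f t z := s z + t * omega z.
have f_ge t : 0 <= t -> forall z, O z -> m - t * W <= f t z.
  move=> t0 z Oz; apply: lerD; first exact: s_ge.
  by rewrite -mulrN ler_wpM2l// lerNl OW.
pose H t := conjugate O (f t) q.
have H_le t t' : 0 <= t -> 0 <= t' -> H t <= H t' + W * `|t - t'|.
  move=> t0 t'0; apply: conjugate_le => // z Oz.
  have := conjugate_ge O_bounded (f_ge t' t'0) q Oz; rewrite -/(H t') /f.
  have : (t' - t) * omega z <= W * `|t - t'|.
    apply: le_trans (ler_norm _) _; rewrite normrM distrC mulrC ler_wpM2r//.
    by rewrite ltr0_norm ?omega_lt0// OW.
  by lra.
have H0 : H 0 = s^* q.
  by rewrite /H (_ : f 0 = s)//; apply/funext => z; rewrite /f mul0r addr0.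
have He : s^* q + a * eps <= H eps.
  apply: le_trans (conjugate_ge O_bounded (f_ge eps (ltW e0)) q Oy0).
  have : eps * a <= eps * - omega y0 by rewrite ler_pM2l// Ua//; exact: kU.
  by rewrite qy0 /f; lra.
(* [H] is controlled for [t >= 0] only; extended by a constant it is Lipschitz on the whole line. *)
pose G (t : R) := H (Num.max 0 t).
have G_lip t t' : `|G t - G t'| <= W * `|t - t'|.
  have max_lip : `|Num.max 0 t - Num.max 0 t'| <= `|t - t'|.
    have := ler_norm (t - t'); have := ler_norm (t' - t); rewrite distrC ler_norml.
    by case: (leP 0 t); case: (leP 0 t') => *; apply/andP; split; lra.
  have max_ge0 x : 0 <= Num.max 0 x :> R by rewrite le_max lexx.
  have h3 : W * `|Num.max 0 t - Num.max 0 t'| <= W * `|t - t'|.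
    by rewrite ler_wpM2l// ltW.
  have h4 := H_le _ _ (max_ge0 t) (max_ge0 t').
  have h5 := H_le _ _ (max_ge0 t') (max_ge0 t); rewrite distrC in h5.
  by rewrite /G ler_norml; apply/andP; split; lra.
have GE t : 0 <= t -> G t = H t by move=> t_ge0; rewrite /G max_r.
have [t] : exists2 t, t \in `[0, eps] & G t = h.
  apply: IVT; first exact: ltW.
    by apply: continuous_subspaceT; exact: (@lipschitz_continuous_fun R R^o G W).
  rewrite (GE 0 (lexx 0)) (GE eps (ltW e0)) H0.
  by rewrite ge_min le_max (ltW h1)/= (le_trans (ltW h2) He) orbT.
rewrite in_itv/= => /andP[t_ge0 te]; rewrite GE// => Ht.
have t0 : 0 < t.
  by rewrite lt_def t_ge0 andbT; apply/eqP => t0; move: h1; rewrite -Ht t0 H0 ltxx.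
have te' : t < eps.
  rewrite lt_def te andbT; apply/eqP => t_eps; move: He.
  by rewrite leNgt t_eps Ht -t_eps h2.
have Oc0 : c !=set0 by exists y0; exact/Uc/kU.
have cft : {within c, continuous (fun z => dot q z - f t z)}.
  apply: continuous_in_subspaceT => w; rewrite inE => /cO Ow.
  have cw := dot_sub_continuous_at (q := q) Ow.
  have co : {for w, continuous omega}.
    exact/differentiable_continuous/omega_differentiable.
  have ct : {for w, continuous (fun=> t : R)} by exact: cst_continuous.
  rewrite (_ : (fun z => _) = (fun z => dot q z - s z) \- (fun z => t * omega z)).
    exact: (continuousB cw (continuousM ct co)).
  by apply/funext => z; rewrite /f /=; ring.
(* The maximum is taken over the compact [c]. Outside [U] all values lie below [s^* q], which [y0]
   reaches, so it is attained in [U] and is the maximum over [O]. *)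
have [y1] := @EVT_max_rV _ _ _ c Oc0 cc cft.
rewrite inE => cy1 y1max.
have Oy1 := cO _ cy1.
have y01 : dot q y0 - f t y0 <= dot q y1 - f t y1.
  by apply: y1max; rewrite inE; exact/Uc/kU.
have fy0 : s^* q <= dot q y0 - f t y0.
  have : t * omega y0 <= 0 by rewrite pmulr_rle0// ltW// omega_lt0.
  by rewrite qy0 /f; lra.
have outside z : O z -> ~ U z -> dot q z - f t z < s^* q.
  move=> Oz Uz; have := gapq z Oz Uz.
  have : t * - omega z <= eps * W by apply: ler_pM; rewrite ?OW// oppr_ge0 ltW ?omega_lt0.
  by rewrite /f; lra.
have Uy1 : U y1.
  apply: contrapT => nU; have := outside _ Oy1 nU.
  by rewrite ltNge (le_trans fy0 y01).
have Hy1 : H t = dot q y1 - f t y1.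
  apply/eqP; rewrite eq_le (conjugate_ge O_bounded (f_ge t t_ge0))// andbT.
  apply: conjugate_le => // z Oz; have [Uz|nUz] := pselect (U z).
    by apply: y1max; rewrite inE; exact: Uc.
  by rewrite (le_trans (ltW (outside _ Oz nUz)))// (le_trans fy0).
exists y1, (q - t *: gradient omega y1), t; split => //=.
- by rewrite t0.
- apply: (subdifferential_subr O_comb (subdifferential_convex O_comb ds_neq0)) => //.
    exact: omega_differentiable.
  by apply/(subdifferential_conjugate O_bounded O_neq0 (f_ge t t_ge0)).
- by rewrite subrK -Ht Hy1 /f; congr pt; ring.
Qed.

End NormalSet.

(** * The Steiner polynomial for small widths *)

Section Steiner.
Variables (R : realType) (n : nat) (B : set (borelType R n.+1)).
Variables (S : 'I_n.+2 -> {measure set (borelType R n.+1) -> \bar R}).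

Definition steiner_sum (eps : R) : \bar R :=
  ((n.+2%:R^-1)%:E *
     \sum_(i < n.+2) (eps ^+ (n.+2 - i) * 'C(n.+2, i)%:R)%:E * S i B)%E.

(** All terms are nonnegative, and in the last one the binomial coefficient [n + 2] cancels the
    prefactor. *)
Lemma steiner_sum_ge eps : 0 < eps -> (eps%:E * S ord_max B <= steiner_sum eps)%E.
Proof.
move=> e0; rewrite /steiner_sum big_ord_recr/= subSnn expr1.
apply: (@le_trans _ _ ((n.+2%:R^-1)%:E * ((eps * 'C(n.+2, n.+1)%:R)%:E * S ord_max B))%E).
  rewrite muleA -EFinM mulrCA binSn.
  by rewrite mulVf ?mulr1// pnatr_eq0.
apply: lee_wpmul2l; first by rewrite lee_fin invr_ge0.
rewrite leeDr// sume_ge0// => i _.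
by rewrite mule_ge0// lee_fin mulr_ge0// exprn_ge0// ltW.
Qed.

(** The terms other than the last carry a factor [eps ^ 2] at least, bounded by it for [eps <= 1];
    [T] does not depend on [eps]. *)
Lemma steiner_sum_le : (forall i, S i B < +oo)%E ->
  exists T : R, forall eps, 0 < eps <= 1 ->
    (steiner_sum eps <= eps%:E * (S ord_max B + (eps * T)%:E))%E.
Proof.
move=> Sfin; have Sf i : S i B \is a fin_num by rewrite ge0_fin_numE.
pose c (i : 'I_n.+2) := 'C(n.+2, i)%:R * fine (S i B).
have c0 i : 0 <= c i by rewrite mulr_ge0// fine_ge0.
exists (\sum_(i < n.+1) c (widen_ord (leqnSn n.+1) i)) => eps /andP[e0 e1].
rewrite /steiner_sum.
under eq_bigr => i _ do rewrite -(fineK (Sf i)) -EFinM -mulrA -/(c i).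
rewrite sumEFin -EFinM -(fineK (Sf ord_max)) -EFinD -EFinM lee_fin.
rewrite big_ord_recr/= subSnn expr1 mulrDr addrC mulrDr; apply: lerD.
  rewrite /c mulrCA ler_pM2l// mulrA -[X in _ <= X]mul1r ler_wpM2r ?fine_ge0//.
  by rewrite binSn mulVf// pnatr_eq0.
apply: (@le_trans _ _ (\sum_(i < n.+1) eps ^+ (n.+2 - i) * c (widen_ord (leqnSn n.+1) i))).
  rewrite ler_piMl//; first by apply: sumr_ge0 => i _; rewrite mulr_ge0// exprn_ge0// ltW.
  by rewrite invf_le1// ler1n.
rewrite mulrA -expr2 mulr_sumr; apply: ler_sum => i _.
rewrite ler_wpM2r// ler_wiXn2l ?(ltW e0)//.
by have := ltn_ord i; lia.
Qed.

End Steiner.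

(** * Two-sided bounds for the area measure *)

Section AreaEstimates.
Variables (R : realType) (n : nat) (O : set 'rV[R]_n.+1) (M m : R).
Variables (s omega : 'rV[R]_n.+1 -> R).
Variable S : 'I_n.+2 -> {measure set (borelType R n.+1) -> \bar R}.
Hypothesis O_open : open O.
Hypothesis O_bounded : forall y, O y -> `|y| <= M.
Hypothesis O_neq0 : O !=set0.
Hypothesis O_comb : forall x y t, O x -> O y -> 0 <= t <= 1 ->
  O ((1 - t) *: x + t *: y).
Hypothesis s_ge : forall y, O y -> m <= s y.
Hypothesis ds_neq0 : forall y, O y -> subdifferential O s y !=set0.
Hypothesis omega_smooth : smooth_on O omega.
Hypothesis omega_convex : @convex_function R 'rV[R]_n.+1 O omega.
Hypothesis omega_lt0 : forall y, O y -> omega y < 0.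
Hypothesis S_radon : forall i, radon_on O (S i).
Hypothesis S_steiner : forall (eps : R) (b : set (borelType R n.+1)),
  0 < eps -> measurable b -> b `<=` O ->
  lebesgue (normal_set O s omega eps b) = steiner_sum b S eps.
Local Notation A := (S ord_max).
Local Notation MA b := (lebesgue (subdifferential_image O s b)).

Let ds_compact := subdifferential_image_compact O_open O_bounded O_neq0 s_ge ds_neq0.

Lemma area_compact_le (k : set 'rV[R]_n.+1) c : compact k -> k `<=` O -> 0 < c ->
  (forall y, k y -> - omega y <= c) -> (A (k : set (borelType R n.+1)) <= c%:E * MA k)%E.
Proof.
move=> ck kO c0 kc.
have [L L0 kL] := gradient_bounded O_open omega_smooth ck kO.
rewrite muleC -lee_pdivrMr//; apply: lebesgue_thickening; first exact: ds_compact.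
move=> r r0; rewrite lee_pdivrMr//.
(* The radius [r] comes first and the width [e = r / L] follows, so that the shift [t grad omega y]
   stays within the thickening. *)
have [e e0 eL] : exists2 e, 0 < e & e * L = r.
  by exists (r / L); [rewrite divr_gt0|rewrite divfK// gt_eqF].
have := normal_set_le O_bounded O_neq0 s_ge omega_smooth omega_convex omega_lt0 kO c0 e0 kc kL.
rewrite S_steiner//; last exact: compact_borel.
move/(le_trans (steiner_sum_ge _ _ e0)).
by rewrite eL (mulrC c) EFinM -muleA lee_pmul2l// muleC.
Qed.

Lemma area_gap_ge (k U c : set 'rV[R]_n.+1) a g : k `<=` U -> open U -> U `<=` c ->
  compact k -> compact c -> c `<=` O -> 0 < a -> (forall y, U y -> a <= - omega y) -> 0 < g ->
  (a%:E * lebesgue (gap_set O s k U g) <= A (U : set (borelType R n.+1)))%E.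
Proof.
move=> kU oU Uc ck cc cO a0 Ua g0.
have [W W0 OW] := omega_bounded O_bounded O_neq0 omega_smooth omega_convex.
have mU : measurable (U : set (borelType R n.+1)) by exact: open_borel.
have Sfin i : (S i (U : set (borelType R n.+1)) < +oo)%E.
  apply: le_lt_trans (S_radon i cc cO); apply: le_measure; rewrite ?inE//.
  exact: compact_borel.
have [T ST] := steiner_sum_le Sfin.
have bound eps : 0 < eps <= 1 -> eps * W < g ->
    (a%:E * lebesgue (gap_set O s k U g) <= A (U : set (borelType R n.+1)) + (eps * T)%:E)%E.
  move=> /[dup] e01 /andP[e0 e1] eW.
  have fib q h : gap_set O s k U g q -> conjugate O s q < h < conjugate O s q + a * eps ->
      normal_set O s omega eps U (pt q h).
    exact: (normal_set_fibre O_open O_bounded O_neq0 O_comb s_ge ds_neq0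
      omega_smooth omega_lt0 kU Uc cc cO a0 Ua W0 OW e0 eW).
  have := lebesgue_fibre_ge (mulr_gt0 a0 e0) fib.
  rewrite S_steiner//; last by move=> y /Uc /cO.
  move/le_trans => /(_ _ (ST _ e01)).
  by rewrite (mulrC a) EFinM -muleA lee_pmul2l.
apply/lee_addgt0Pr => e e0.
(* Three demands: [eps <= 1] for the Steiner bound, [eps * W < g] for the fibres, [eps * T <= e] for
   the remainder. *)
pose eps := Num.min 1 (Num.min (g / (2 * W)) (e / (`|T| + 1))).
have T1 : 0 < `|T| + 1 by rewrite ltr_wpDl.
have e'0 : 0 < eps by rewrite !lt_min ltr01 !divr_gt0// mulr_gt0.
have e'1 : eps <= 1 by rewrite ge_min lexx.
have e'W : eps * W < g.
  have : eps <= g / (2 * W) by rewrite !ge_min lexx orbT.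
  rewrite ler_pdivlMr ?mulr_gt0// => h.
  have : 0 < eps * W by rewrite mulr_gt0.
  by lra.
have e'T : eps * T <= e.
  have : eps <= e / (`|T| + 1) by rewrite !ge_min lexx !orbT.
  rewrite ler_pdivlMr// => h.
  have : eps * T <= eps * `|T| by rewrite ler_pM2l// ler_norm.
  by move: h; rewrite mulrDr mulr1; lra.
apply: (le_trans (bound eps _ e'W)); first by rewrite e'0.
by rewrite leeD2l// lee_fin.
Qed.

Lemma lebesgue_nondecreasing_le (F : nat -> set 'rV[R]_n.+1) (c : \bar R) a :
  (forall j, measurable (F j : set (borelType R n.+1))) -> nondecreasing_seq F ->
  0 < a -> (forall j, (a%:E * lebesgue (F j) <= c)%E) ->
  (a%:E * lebesgue (\bigcup_j F j) <= c)%E.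
Proof.
move=> mF ndF a0 Fc.
have cv : (@borel_lebesgue R n) \o F @ \oo --> @borel_lebesgue R n (\bigcup_j F j).
  by apply: nondecreasing_cvg_mu => //; exact: bigcup_measurable.
rewrite muleC -lee_pdivlMr//.
suff : (@borel_lebesgue R n (\bigcup_j F j) <= c * (a^-1)%:E)%E by [].
by apply: cvge_le cv; apply: nearW => j; rewrite lee_pdivlMr// muleC; exact: Fc.
Qed.

Lemma area_open_compact_ge (k U c : set 'rV[R]_n.+1) a : k `<=` U -> open U -> U `<=` c ->
  compact k -> compact c -> c `<=` O -> 0 < a -> (forall y, U y -> a <= - omega y) ->
  (a%:E * MA k <= A (U : set (borelType R n.+1)))%E.
Proof.
move=> kU oU Uc ck cc cO a0 Ua.
have UO : U `<=` O by move=> y /Uc /cO.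
have kO : k `<=` O by move=> y /kU /UO.
pose F (j : nat) := gap_set O s k U (j.+1%:R^-1).
have main : (a%:E * lebesgue (\bigcup_j F j) <= A (U : set (borelType R n.+1)))%E.
  apply: lebesgue_nondecreasing_le => //.
  - move=> j; apply: closed_borel.
    exact: (gap_set_closed O_open O_bounded O_neq0 s_ge ds_neq0).
  - move=> i j ij; apply/subsetPset => q [dq gq]; split=> // z Oz Uz.
    apply: le_trans (gq z Oz Uz); rewrite lerD2l lef_pV2 ?posrE// ler_nat.
    exact: ij.
  - by move=> j; apply: (area_gap_ge kU oU Uc ck cc cO a0 Ua); rewrite invr_gt0.
apply: le_trans main; rewrite lee_pmul2l//.
apply: (@le_trans _ _ (lebesgue ((\bigcup_j F j) `|` multiply_supported O s))).
  apply: le_lebesgue => q dq; have [mq|mq] := pselect (multiply_supported O s q).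
    by right.
  have [N qN] := gap_exists O_open O_bounded O_neq0 O_comb s_ge ds_neq0 kU oU UO dq mq.
  by left; exists N.
apply: le_trans (outer_measureU2 (@lebesgue R n.+1) _ _) _ => /=.
by rewrite (multiply_supported_null O_bounded O_neq0 s_ge) adde0.
Qed.

(** The image of [U] is the increasing union of the images of its closed cores, which are compact,
    so continuity from below applies. *)
Lemma area_open_ge (U c : set 'rV[R]_n.+1) a : open U -> U `<=` c ->
  compact c -> c `<=` O -> 0 < a -> (forall y, U y -> a <= - omega y) ->
  (a%:E * MA U <= A (U : set (borelType R n.+1)))%E.
Proof.
move=> oU Uc cc cO a0 Ua.
have [cF FU ndF UF] := closed_coreP oU.
have ck j : compact (closed_core U j).
  by apply: (subclosed_compact _ cc) => //; apply: subset_trans Uc.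
have kO j : closed_core U j `<=` O by move=> y /FU /Uc /cO.
have -> : subdifferential_image O s U =
    \bigcup_j subdifferential_image O s (closed_core U j).
  rewrite /subdifferential_image -{1}UF.
  apply/seteqP; split => [q [y [j _ yj] dq]|q [j _ [y yj dq]]].
    by exists j => //; exists y.
  by exists y => //; exists j.
apply: lebesgue_nondecreasing_le => //.
- by move=> j; apply: compact_borel; exact: ds_compact.
- move=> i j ij; apply/subsetPset => q [y yi dq]; exists y => //.
  by have /subsetPset := ndF _ _ ij; exact.
- by move=> j; exact: (area_open_compact_ge (FU j) oU Uc (ck j) cc cO a0 Ua).
Qed.

Section CompactCarrier.
Variables (k : set 'rV[R]_n.+1) (b : set (borelType R n.+1)).
Hypotheses (k_compact : compact k) (kO : k `<=` O) (mb : measurable b) (bk : b `<=` k).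

Let A_approx (e : R) (e0 : 0 < e) :=
  borel_compact_open_approx (mu := A) (S_radon ord_max) O_open k_compact kO mb bk e0.

Lemma area_fin_num : A b \is a fin_num.
Proof.
rewrite ge0_fin_numE//; apply: le_lt_trans (S_radon ord_max k_compact kO).
by apply: le_measure; rewrite ?inE//; exact: compact_borel.
Qed.

Lemma area_le c : 0 < c -> (forall y, b y -> - omega y <= c) -> (A b <= c%:E * MA b)%E.
Proof.
move=> c0 bc; apply/lee_addgt0Pr => e e0.
have [F [U [cs [cF oU Fb bU [Ucs ccs csO UF]]]]] := A_approx e0.
have mF : measurable (F : set (borelType R n.+1)) by exact: compact_borel.
have mU : measurable (U : set (borelType R n.+1)) by exact: open_borel.
apply: (@le_trans _ _ (A ((F : set (borelType R n.+1)) `|` (U `\` F)))).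
  apply: le_measure; rewrite ?inE//; first by apply: measurableU => //; exact: measurableD.
  by move=> y by_; have [?|?] := pselect (F y); [left|right; split => //; exact: bU].
apply: le_trans (measureU2 _ mF (measurableD mU mF)) _.
apply: leeD UF; apply: le_trans (area_compact_le cF _ c0 _) _.
- by move=> y /Fb /bk /kO.
- by move=> y /Fb; exact: bc.
- rewrite lee_pmul2l//; apply: le_lebesgue => q [y Fy dq]; exists y => //; exact: Fb.
Qed.

(** Here the approximation is from outside, where [a <= - omega] may fail; it is relaxed to [a - e],
    which holds on the open neighbourhood [V] of [b]. Taking [e = a / 2] first shows [MA b] finite,
    so that [e] can tend to 0. *)
Lemma area_ge a : 0 < a -> (forall y, b y -> a <= - omega y) -> (a%:E * MA b <= A b)%E.
Proof.
move=> a0 ba.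
have bound e : 0 < e -> e < a -> ((a - e)%:E * MA b <= A b + e%:E)%E.
  move=> e0 ea.
  have [F [U [cs [cF oU Fb bU [Ucs ccs csO UF]]]]] := A_approx e0.
  have mF : measurable (F : set (borelType R n.+1)) by exact: compact_borel.
  have mU : measurable (U : set (borelType R n.+1)) by exact: open_borel.
  pose V := U `&` [set y | O y /\ a - e < - omega y].
  have oV : open V.
    apply: openI => //; rewrite openE => y [Oy ay].
    have cy : {for y, continuous (fun z => - omega z)}.
      apply: continuousN; apply: differentiable_continuous.
      exact: (omega_differentiable omega_smooth).
    have n1 := open_nbhs_nbhs (conj O_open Oy).
    have n2 : nbhs y ((fun z => - omega z) @^-1` [set x | a - e < x]).
      by apply: cy; apply: open_nbhs_nbhs; split => //; exact: open_gt.
    by apply: filterS (filterI n1 n2) => z [].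
  have mV : measurable (V : set (borelType R n.+1)) by exact: open_borel.
  have bV : b `<=` V.
    move=> y by_; split; first exact: bU.
    by split; [exact/kO/bk|have := ba _ by_; lra].
  have ae : 0 < a - e by rewrite subr_gt0.
  apply: (@le_trans _ _ ((a - e)%:E * MA V)%E).
    by rewrite lee_pmul2l//; apply: le_lebesgue => q [y by_ dq]; exists y => //; exact: bV.
  apply: le_trans (area_open_ge oV (c := cs) _ ccs csO ae _) _.
  - by move=> y [/Ucs].
  - by move=> y [_ [_ /ltW]].
  apply: (@le_trans _ _ (A ((F : set (borelType R n.+1)) `|` (U `\` F)))).
    apply: le_measure; rewrite ?inE//; first by apply: measurableU => //; exact: measurableD.
    by move=> y [Uy _]; have [?|?] := pselect (F y); [left|right].
  apply: le_trans (measureU2 _ mF (measurableD mU mF)) _.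
  by apply: leeD UF; apply: le_measure; rewrite ?inE.
have MAfin : MA b \is a fin_num.
  rewrite ge0_fin_numE ?lebesgue_ge0//.
  have a2 : 0 < a / 2 by rewrite divr_gt0.
  have := bound (a / 2) a2; rewrite ltr_pdivrMr// mulrDr mulr1 ltrDl => /(_ a0).
  rewrite (_ : a - a / 2 = a / 2); last lra.
  rewrite muleC -lee_pdivlMr// => /le_lt_trans; apply.
  rewrite -(fineK area_fin_num) -EFinD -EFinM; exact: ltry.
rewrite -(fineK MAfin) -(fineK area_fin_num) -EFinM lee_fin.
set x := fine (MA b); set y := fine (A b).
have x0 : 0 <= x by rewrite fine_ge0// lebesgue_ge0.
have {}bound e : 0 < e -> e < a -> (a - e) * x <= y + e.
  by move=> e0 ea; have := bound e e0 ea; rewrite -(fineK MAfin) -(fineK area_fin_num).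
apply/ler_addgt0Pr => e e0.
pose e' := Num.min (a / 2) (e / (x + 1)).
have x1 : 0 < x + 1 by rewrite ltr_wpDl.
have e'0 : 0 < e' by rewrite lt_min !divr_gt0.
have e'a : e' < a.
  by apply: (@le_lt_trans _ _ (a / 2)); [rewrite ge_min lexx|lra].
have := bound _ e'0 e'a.
have : e' * (x + 1) <= e by rewrite -ler_pdivlMr// ge_min lexx orbT.
by move=> ? ?; lra.
Qed.

End CompactCarrier.

Let core_compact j : compact (closed_core O j).
Proof.
have [cF FO _ _] := closed_coreP O_open.
apply: bounded_closed_compact => //.
exists M; split; first exact: num_real.
by move=> x Mx y /FO /O_bounded yM; exact: le_trans yM (ltW Mx).
Qed.

(** [MA] is only known to be subadditive. For this inequality that is the right direction: [b] is
    split into disjoint shells, over which [A] adds up exactly. *)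
Lemma area_borel_ge (b : set (borelType R n.+1)) a : measurable b -> b `<=` O -> 0 < a ->
  (forall y, b y -> a <= - omega y) -> (a%:E * MA b <= A b)%E.
Proof.
move=> mb bO a0 ba; have [cF FO ndF FU] := closed_coreP O_open.
pose F j : set (borelType R n.+1) := closed_core O j.
have mF j : measurable (F j) by exact: closed_borel.
have mD j : measurable (b `&` seqD F j).
  apply: measurableI => //; case: j => [|j]; first exact: mF.
  by apply: measurableD; exact: mF.
have DF j : seqD F j `<=` F j by case: j => [//|j] y [].
have bE : b = \bigcup_j (b `&` seqD F j).
  rewrite -setI_bigcupr eq_bigcup_seqD.
  by rewrite [X in _ `&` X]FU; apply/esym/setIidl.
have AE : A b = (\sum_(0 <= j <oo) A (b `&` seqD F j))%E.
  rewrite {1}bE; apply: measure_semi_bigcup => //.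
    by apply: trivIset_setIl; exact: trivIset_seqD.
  by rewrite -bE.
rewrite AE; apply: (@le_trans _ _ (\sum_(0 <= j <oo) a%:E * MA (b `&` seqD F j))%E).
  rewrite nneseriesZl; last by move=> j _; exact: lebesgue_ge0.
  rewrite lee_pmul2l//.
  apply: le_trans (lebesgue_sigma_subadditive _).
  apply: le_lebesgue => q [y by_ dq].
  have [j _ yj] : (\bigcup_j (b `&` seqD F j)) y by rewrite -bE.
  by exists j => //; exists y.
apply: lee_nneseries => [j _ _|j _].
  by rewrite mule_ge0 ?lebesgue_ge0// lee_fin ltW.
have bF : b `&` seqD F j `<=` closed_core O j by move=> y [_ /DF].
by apply: (area_ge (@core_compact j) (FO j) (mD j) bF a0) => y [/ba].
Qed.

(** Increasing pieces instead of shells: [A] is continuous along them, and of [MA] only monotonicity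
    is used. *)
Lemma area_borel_le (b : set (borelType R n.+1)) c : measurable b -> b `<=` O -> 0 < c ->
  (forall y, b y -> - omega y <= c) -> (A b <= c%:E * MA b)%E.
Proof.
move=> mb bO c0 bc; have [cF FO ndF FU] := closed_coreP O_open.
pose F j : set (borelType R n.+1) := b `&` closed_core O j.
have mF j : measurable (F j) by apply: measurableI => //; exact: closed_borel.
have bE : \bigcup_j F j = b by rewrite -setI_bigcupr FU; exact: setIidl.
have cvA : A \o F @ \oo --> A b.
  rewrite -[in X in _ --> X]bE; apply: nondecreasing_cvg_mu => //; first by rewrite bE.
  by move=> i j ij; apply/subsetPset; apply: setIS; apply/subsetPset/ndF.
apply: cvge_le cvA; apply: nearW => j /=.
apply: (@le_trans _ _ (c%:E * MA (F j))%E).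
  have bF : F j `<=` closed_core O j by move=> y [].
  by apply: (area_le (@core_compact j) (FO j) (mF j) bF c0) => y [/bc].
by rewrite lee_pmul2l//; apply: le_lebesgue => q [y [by_ _] dq]; exists y.
Qed.

End AreaEstimates.

(** * From two-sided bounds to the integral formula *)

Section SetFunctionIntegral.
Context d (T : measurableType d) (R : realType).
Variable mu : set T -> \bar R.
Hypothesis mu0 : mu set0 = 0%E.
Import HBNNSimple.

Lemma sintegral_range (h : {nnsfun T >-> R}) :
  sintegral mu h = (\sum_(x \in range h) x%:E * mu (h @^-1` [set x]))%E.
Proof.
rewrite sintegralET [RHS](fsbig_widen (range h) setT)//= => x [_ Nhx] /=.
by rewrite preimage10// mu0 mule0.
Qed.

(** [integral] makes sense for any set function, as a difference of suprema over simple functions;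
    [mu0] makes the one for the negative part vanish. *)
Lemma ge0_integral_sup (D : set T) (f : T -> \bar R) : (forall x, D x -> (0 <= f x)%E) ->
  integral mu D f = ereal_sup [set sintegral mu h |
    h in [set h : {nnsfun T >-> R} | forall x, ((h x)%:E <= (f \_ D) x)%E]].
Proof.
move=> f0; have g0 x : (0 <= (f \_ D) x)%E by exact: erestrict_ge0.
rewrite /integral.
have -> : ((f \_ D)^\+)%E = f \_ D.
  by apply/funext => x; rewrite (ge0_funeposE (D := setT))// inE.
have -> : ((f \_ D)^\-)%E = cst 0%E.
  by apply/funext => x; rewrite (ge0_funenegE (D := setT))// inE.
rewrite [X in (_ - X)%E](_ : _ = 0%E) ?sube0//.
apply/eqP; rewrite eq_le; apply/andP; split.
  apply: ge_ereal_sup => _ [h /= h0 <-].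
  rewrite sintegral_range fsbig1// => x [t _ <-].
  by rewrite (_ : h t = 0) ?mul0e//; apply/eqP; rewrite eq_le fun_ge0 andbT -lee_fin.
apply: ereal_sup_ubound; exists nnsfun0; first by move=> x /=.
by rewrite sintegral_range fsbig1// => x [t _ <-]; rewrite mul0e.
Qed.

End SetFunctionIntegral.

Section DensityFromBounds.
Context d (T : measurableType d) (R : realType).
Variables (mu : set T -> \bar R) (nu : {measure set T -> \bar R}).
Variables (O b : set T) (f : T -> R).
Hypothesis mu0 : mu set0 = 0%E.
Hypothesis mu_ge0 : forall c, (0 <= mu c)%E.
Hypothesis le_mu : {homo mu : c c' / c `<=` c' >-> (c <= c')%E}.
Hypothesis f_gt0 : forall y, O y -> 0 < f y.
Hypothesis mu_le : forall c a, measurable c -> c `<=` O -> 0 < a ->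
  (forall y, c y -> a <= f y) -> (a%:E * mu c <= nu c)%E.
Hypothesis nu_le : forall c a, measurable c -> c `<=` O -> 0 < a ->
  (forall y, c y -> f y <= a) -> (nu c <= a%:E * mu c)%E.
Hypotheses (mb : measurable b) (bO : b `<=` O) (mf : measurable_fun b f).
Import HBNNSimple.

Let g := (fun y => (f y)%:E) \_ b.

Let range_cover (c : set T) (h : {nnsfun T >-> R}) : measurable c ->
  nu c = (\sum_(x \in range h) nu (c `&` h @^-1` [set x]))%E.
Proof.
move=> mc; rewrite -measure_fsbig//.
- transitivity (nu (c `&` \big[setU/set0]_(x \in range h) (h @^-1` [set x]))).
    by rewrite nnsfun_cover setIT.
  by rewrite !fsbig_finite//= big_distrr.
- exact/trivIset_setIl/trivIset_preimage1.
Qed.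

Lemma sintegral_le_density (h : {nnsfun T >-> R}) :
  (forall x, ((h x)%:E <= g x)%E) -> (sintegral mu h <= nu b)%E.
Proof.
move=> hg; rewrite sintegral_range// (range_cover h mb); apply: lee_fsum => // x [t _ htx].
have x0 : 0 <= x by rewrite -htx fun_ge0.
have [->|xn0] := eqVneq x 0; first by rewrite mul0e.
have xgt0 : 0 < x by rewrite lt_def xn0.
have hb : h @^-1` [set x] `<=` b.
  move=> y hy; apply: contrapT => nby; have := hg y.
  rewrite /g /patch memNset// hy lee_fin leNgt.
  by rewrite xgt0.
have -> : b `&` h @^-1` [set x] = h @^-1` [set x] by apply/setIidr.
apply: mu_le => //; first by move=> y /hb /bO.
move=> y hy; have := hg y; rewrite hy /g /patch mem_set ?lee_fin//.
exact: hb.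
Qed.

(** As [mu] need not be additive, monotone convergence is run on [nu]. The sets where
    [f <= th * h n] increase to [b], because [f > 0] and [th > 1] leave room in the convergence of
    [h n]; on each level set of [h n] the upper bound for [nu] applies. *)
Lemma density_le_integral (th : R) : 1 < th ->
  (nu b <= th%:E * \int[mu]_(y in b) (f y)%:E)%E.
Proof.
move=> th1; have th0 : 0 < th by exact: lt_trans th1.
have mg : measurable_fun setT g.
  by apply/(measurable_restrictT _ mb)/measurable_EFinP.
pose h := nnsfun_approx measurableT mg.
have g_ge0 x : (0 <= g x)%E.
  by apply: erestrict_ge0 => y /bO /f_gt0 /ltW; rewrite lee_fin.
have hg n x : ((h n x)%:E <= g x)%E.
  by rewrite /h nnsfun_approxE; apply: le_approx.
have hcvg x : EFin \o h^~ x @ \oo --> g x.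
  by apply: cvg_nnsfun_approx.
have nd_h x : nondecreasing_seq (h^~ x).
  by move=> i j ij; have /lefP := nd_nnsfun_approx measurableT mg ij; exact.
have ge_sint n : (sintegral mu (h n) <= \int[mu]_(y in b) (f y)%:E)%E.
  rewrite ge0_integral_sup//; last by move=> y /bO /f_gt0 /ltW; rewrite lee_fin.
  by apply: ereal_sup_ubound; exists (h n).
pose B n := b `&` [set y | f y <= th * h n y].
have mB n : measurable (B n).
  apply: (measurable_fun_le mb mf).
  by apply: measurable_funM => //; exact: measurable_funTS.
have ndB : nondecreasing_seq B.
  move=> i j ij; apply/subsetPset => y [by_ fy]; split => //=.
  by apply: (le_trans fy); rewrite ler_pM2l//; exact: nd_h.
have UB : \bigcup_n B n = b.
  apply/seteqP; split => [y [n _ []//]|y by_].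
  have fy0 : 0 < f y by exact/f_gt0/bO.
  have := hcvg y; rewrite /g /patch mem_set// => /fine_cvgP[_ /cvgrPdist_lt].
  have e0 : 0 < f y - f y / th by rewrite subr_gt0 ltr_pdivrMr// ltr_pMr.
  move=> /(_ _ e0)[n _ /(_ n (leqnn n))] /=; rewrite ltr_norml => /andP[_ hn].
  exists n => //; split => //=; rewrite mulrC -ler_pdivrMr//; lra.
have cvB : nu \o B @ \oo --> nu b.
  by rewrite -[in X in _ --> X]UB; apply: nondecreasing_cvg_mu => //; rewrite UB.
apply: cvge_le cvB; apply: nearW => n /=.
apply: le_trans (lee_wpmul2l _ (ge_sint n)); last by rewrite lee_fin ltW.
rewrite (range_cover (h n) (mB n)) sintegral_range// ge0_mule_fsumr; last first.
  move=> x; have [x0|x0] := leP 0 x; first by rewrite mule_ge0// lee_fin.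
  rewrite preimage10 ?mu0 ?mule0// => -[t _ htx].
  by move: x0; rewrite -htx ltNge fun_ge0.
apply: lee_fsum => // x [t _ htx].
have x0 : 0 <= x by rewrite -htx fun_ge0.
have [->|xn0] := eqVneq x 0.
  rewrite mul0e mule0 (_ : _ `&` _ = set0) ?measure0// -subset0.
  move=> y [[by_ /= fy] /= hy]; move: fy; rewrite hy mulr0 leNgt.
  by rewrite f_gt0//; exact: bO.
have xgt0 : 0 < x by rewrite lt_def xn0.
rewrite muleA -EFinM.
apply: (@le_trans _ _ ((th * x)%:E * mu (B n `&` h n @^-1` [set x]))%E).
  apply: nu_le => //.
  - exact: measurableI.
  - by move=> y [[/bO]].
  - exact: mulr_gt0.
  - by move=> y [[_ /= fy] <-].
apply: lee_wpmul2l; first by rewrite lee_fin mulr_ge0// ltW.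
by apply: le_mu => y [].
Qed.

Lemma density_from_bounds : nu b = (\int[mu]_(y in b) (f y)%:E)%E.
Proof.
apply/eqP; rewrite eq_le; apply/andP; split; last first.
  rewrite ge0_integral_sup//; last by move=> y /bO /f_gt0 /ltW; rewrite lee_fin.
  by apply: ge_ereal_sup => _ [h /= hg <-]; exact: sintegral_le_density.
apply/lee_mul01Pr => // r /andP[r0 r1].
by rewrite -lee_pdivlMl//; apply: density_le_integral; rewrite invf_gt1.
Qed.

End DensityFromBounds.

Lemma continuous_borel_fun (R : realType) n (O : set 'rV[R]_n) (f : 'rV[R]_n -> R)
    (b : set (borelType R n)) : open O -> (forall y, O y -> {for y, continuous f}) ->
  measurable b -> b `<=` O -> measurable_fun b (f : borelType R n -> R).
Proof.
move=> oO cf mb bO.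
apply: (measurability _ (RGenOInfty.measurableE R)) => // _ [_ [x ->] <-].
have oV : open (O `&` f @^-1` [set r | x < r]).
  rewrite openE => y [Oy xy].
  have n1 := open_nbhs_nbhs (conj oO Oy).
  have n2 : nbhs y (f @^-1` [set r | x < r]).
    by apply: cf => //; apply: open_nbhs_nbhs; split => //; exact: open_gt.
  by apply: filterS (filterI n1 n2).
rewrite (_ : b `&` _ = b `&` (O `&` f @^-1` [set r | x < r])).
  by apply: measurableI => //; exact: open_borel.
apply/seteqP; split => y /=; rewrite in_itv/= andbT.
  by move=> [by_ xy]; split => //; split => //; exact: bO.
by move=> [? []].
Qed.

Theorem proposition4p15 (R : realType) (d : nat) (hd : (2 <= d)%N)
    (C : set 'rV[R]_(d + 1)) (hCopen : open C) (hC : proper_convex_cone C)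
    (Omega : set 'rV[R]_d) (hOopen : open Omega) (hOconv : convex_set Omega)
    (hObnd : bounded_set Omega) (hO0 : Omega 0) (hCO : C = cone_over Omega)
    (omega : 'rV[R]_d -> R) (homega : cheng_yau_solution (polar Omega) omega)
    (K : set 'rV[R]_(d + 1)) (hK : C_convex_domain C K)
    (A : {measure set (borelType R d) -> \bar R})
    (hA : is_area_measure (polar Omega) omega K A) :
  forall b : set (borelType R d),
    measurable b -> (b : set 'rV[R]_d) `<=` polar Omega ->
    A b = (\int[monge_ampere (polar Omega) (support_function K)]_(y in b)
             (- omega y)%:E)%E.
Proof.
case: d hd C hCopen hC Omega hOopen hOconv hObnd hO0 hCO omega homega K hK A hA
  => [//|n] _ C _ _ Omega Omega_open _ Omega_bounded Omega0 -> omega homega K hK A hA b mb bO.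
have [S [S_radon S_steiner <-]] := hA.
have [K_domain K_cone K_directions _] := hK.
have [omega_smooth omega_convex omega_lt0 _ _] := homega.
set O := polar Omega in bO S_radon S_steiner homega omega_smooth omega_convex omega_lt0 *.
set s := support_function K.
have O_open : open O by exact: polar_open.
have [M M0 O_bounded] := polar_bounded Omega_open Omega0.
have O_neq0 : O !=set0 by exists 0; exact: polar0.
have O_comb x y t : O x -> O y -> 0 <= t <= 1 -> O ((1 - t) *: x + t *: y).
  exact: polar_comb.
have [X0 KX0] := domain_neq0 K_domain.
(* One point [X0] of [K] bounds [s] from below by an affine function, and [m] bounds that function
   on the bounded polar. *)
pose m := - (n.+1%:R * M * `|lsubmx X0|) - height X0.
have s_ge y : O y -> m <= s y.
  move=> Oy.
  have := lt_support Omega_bounded Omega0 K_domain K_cone K_directions Oy KX0.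
  move/ltW; apply: le_trans.
  rewrite -{1}(pt_eta X0) dot_pt /m mulrN1 lerD2r.
  have := dot_le_radius O_bounded (- lsubmx X0) Oy.
  by rewrite dotNl normrN; lra.
have ds_neq0 y : O y -> subdifferential O s y !=set0.
  exact: (subdifferential_neq0 Omega_bounded Omega0 K_domain K_cone K_directions).
have steiner (eps : R) (c : set (borelType R n.+1)) : 0 < eps -> measurable c -> c `<=` O ->
    lebesgue (normal_set O s omega eps c) = steiner_sum c S eps.
  move=> e0 mc cO; rewrite /steiner_sum -S_steiner//; congr lebesgue.
  have nE Z := normal_nbhdE Omega_open Omega_bounded Omega0 K_domain K_cone
    K_directions omega eps Z cO.
  by apply/seteqP; split => Z /nE.
have MAE (c : set (borelType R n.+1)) : c `<=` O ->
    monge_ampere O s c = lebesgue (subdifferential_image O s c).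
  by move=> cO; rewrite /monge_ampere (setIidl cO).
apply: (@density_from_bounds _ _ _ _ (S ord_max) O b (fun y => - omega y)) => //.
- by rewrite /monge_ampere set0I bigcup_set0; exact: lebesgue_set0.
- by move=> c; exact: lebesgue_ge0.
- move=> c c' cc'; apply: le_lebesgue => q [y [cy Oy] dq]; exists y => //; split => //.
  exact: cc'.
- by move=> y Oy; rewrite oppr_gt0 omega_lt0.
- move=> c a mc cO a0 ca; rewrite MAE//.
  exact: (area_borel_ge O_open O_bounded O_neq0 O_comb s_ge ds_neq0 omega_smooth
    omega_convex omega_lt0 S_radon steiner mc cO a0 ca).
- move=> c a mc cO a0 ca; rewrite MAE//.
  exact: (area_borel_le O_open O_bounded O_neq0 s_ge ds_neq0 omega_smooth
    omega_convex omega_lt0 S_radon steiner mc cO a0 ca).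
- apply: (continuous_borel_fun (O := O)) => // y Oy.
  apply: continuousN; apply: differentiable_continuous.
  exact: (omega_differentiable omega_smooth).
Qed.
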